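(* Let $k$ be a field and let $A=kQ/I$ be a triangular quadratic string algebra. Then for all integers $n>0$ and $m>0$ one has ${\rm HH}^n(A)\cup{\rm HH}^m(A)=0$, i.e. the cup product of any class in ${\rm HH}^n(A)$ with any class in ${\rm HH}^m(A)$ is zero in ${\rm HH}^{n+m}(A)$.
   Context: $Q$ is a finite quiver, $kQ$ its path algebra, and $I$ an admissible ideal of $kQ$; paths are composed left to right (for arrows $\alpha,\beta$ with $t(\alpha)=s(\beta)$, $\alpha\beta$ is the path ''first $\alpha$, then $\beta$''). $A$ is triangular if $Q$ has no oriented cycles; quadratic if $I$ is generated by linear combinations of paths of length 2. $A$ is a string algebra if: (S1) $I$ is generated by paths (monomial); (S2) each vertex of $Q$ is the source of at most two arrows and the target of at most two arrows; (S3) for each arrow $\alpha$ there is at most one arrow $\beta$ with $\alpha\beta\notin I$ and at most one arrow $\gamma$ with $\gamma\alpha\notin I$. ${\rm HH}^i(A)={\rm Ext}^i_{A\otimes_k A^{op}}(A,A)$ is the Hochschild cohomology, and $\cup$ is the cup product (equal to the Yoneda product) making ${\rm HH}^*(A)=\bigoplus_{i\ge0}{\rm HH}^i(A)$ a graded commutative ring; at cochain level, for Hochschild cochains $f$ of degree $n$ and $g$ of degree $m$, $(f\cup g)(r_1\otimes\cdots\otimes r_{n+m})=f(r_1\otimes\cdots\otimes r_n)\,g(r_{n+1}\otimes\cdots\otimes r_{n+m})$. *)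

(* Defs.v *)
From HB Require Import structures.
From mathcomp Require Import all_boot all_algebra.
Set Implicit Arguments. Unset Strict Implicit. Unset Printing Implicit Defensive.
Import GRing.Theory.
Local Open Scope ring_scope.

(* Hochschild cochain complex (bar/standard complex) of a k-algebra A,    *)
(* whose multiplication is [mul].  An n-cochain is a k-multilinear map    *)
(* A^n -> A (= a k-linear map A^{(x)n} -> A); arguments are finite        *)
(* families x : 'I_n -> A, i.e. (x_0, ..., x_{n-1}).                       *)
Section Hochschild.
Variables (k : fieldType) (A : lmodType k) (mul : A -> A -> A).

Definition fupd n (x : {ffun 'I_n -> A}) (i : 'I_n) (a : A) : {ffun 'I_n -> A} :=
  [ffun j => if j == i then a else x j].

Definition multilinear n (f : {ffun 'I_n -> A} -> A) : Prop :=
  forall (x : {ffun 'I_n -> A}) (i : 'I_n) (c : k) (a b : A),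
    f (fupd x i (c *: a + b)) = c *: f (fupd x i a) + f (fupd x i b).

Definition ftail n (x : {ffun 'I_n.+1 -> A}) : {ffun 'I_n -> A} :=
  [ffun j => x (lift ord0 j)].
Definition finit n (x : {ffun 'I_n.+1 -> A}) : {ffun 'I_n -> A} :=
  [ffun j => x (widen_ord (leqnSn n) j)].
Definition fmerge n (x : {ffun 'I_n.+1 -> A}) (i : 'I_n) : {ffun 'I_n -> A} :=
  [ffun j : 'I_n => if (j < i)%N then x (widen_ord (leqnSn n) j)
             else if j == i then mul (x (widen_ord (leqnSn n) j)) (x (lift ord0 j))
             else x (lift ord0 j)].

Definition hoch_d n (f : {ffun 'I_n -> A} -> A) (x : {ffun 'I_n.+1 -> A}) : A :=
  mul (x ord0) (f (ftail x))
  + \sum_(i < n) ((-1) ^+ i.+1) *: f (fmerge x i)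
  + ((-1) ^+ n.+1) *: mul (f (finit x)) (x ord_max).

Definition hoch_cocycle n (f : {ffun 'I_n -> A} -> A) : Prop :=
  multilinear f /\ forall x, hoch_d f x = 0.

Definition hoch_cup n m (f : {ffun 'I_n -> A} -> A) (g : {ffun 'I_m -> A} -> A)
  (x : {ffun 'I_(n + m) -> A}) : A :=
  mul (f [ffun j => x (lshift m j)]) (g [ffun j => x (rshift n j)]).

End Hochschild.

(* [rel a b] means the length-2 path "first a, then b" is one of the       *)
(* generators of I; I = ideal generated by these paths (quadratic+monomial)*)
Section Quiver.
Variables (V E : finType) (s t : E -> V) (rel : E -> E -> bool).

Definition triangular : Prop :=
  forall (a : E) (w : seq E), path (fun x y => t x == s y) a w -> t (last a w) != s a.

Definition string_cond : Prop :=
  (forall v : V, #|[pred a | s a == v]| <= 2 /\ #|[pred a | t a == v]| <= 2)%N /\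
  (forall a : E, #|[pred b | (t a == s b) && ~~ rel a b]| <= 1 /\
                 #|[pred c | (t c == s a) && ~~ rel c a]| <= 1)%N.

(* Paths are encoded as (start vertex, list of arrows, composed left to right). *)
Definition arrow_step (a b : E) : bool := (t a == s b) && ~~ rel a b.

(* paths of Q that are nonzero in kQ/I (contain no generator of I) *)
Definition valid_path (p : V * seq E) : bool :=
  if p.2 is a :: w then (s a == p.1) && path arrow_step a w else true.

Definition path_tgt (p : V * seq E) : V :=
  if p.2 is a :: w then t (last a w) else p.1.

Fixpoint words n : seq (seq E) :=
  if n is n'.+1 then [::] :: [seq a :: w | a <- enum E, w <- words n'] else [:: [::]].

(* all such paths (for triangular Q, every path has length < #|V|) *)
Definition paths_list : seq (V * seq E) :=
  [seq p <- [seq (v, w) | v <- enum V, w <- words #|V|] | valid_path p].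

Definition QBasis : finType := seq_sub paths_list.

Definition bmul (b1 b2 : QBasis) : option QBasis :=
  if path_tgt (val b1) == (val b2).1
  then insub ((val b1).1, (val b1).2 ++ (val b2).2) else None.

Variable k : fieldType.

Definition qvec (o : option QBasis) : {ffun QBasis -> k^o} := [ffun b => if o == Some b then 1 else 0].

Definition qmul (x y : {ffun QBasis -> k^o}) : {ffun QBasis -> k^o} :=
  \sum_(b1 : QBasis) \sum_(b2 : QBasis) (x b1 * y b2) *: qvec (bmul b1 b2).

End Quiver.

Notation QAlg s t rel k := {ffun QBasis s t rel -> k^o}.

(* Main.v *)
(* A cochain is given by its coefficients on cells (xs; b), where xs is a tuple
   of paths and b a path.  Discrete Morse theory on these cells: scanning xs
   from the left, starting at the source of b, a tuple which is not a composable
   chain of arrows with zero consecutive products, ending at the target of b, is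
   paired with the tuple obtained by inserting a trivial path or by splitting
   off the first arrow of a path.  Hence a bar cocycle vanishing on the Koszul
   cells (those chains of arrows) is a coboundary.  For a triangular string
   algebra the Koszul cells pair further: (x; b) with (cx; cb), or else with
   (xd; bd), such arrows c and d being unique by the string condition.  So in
   degree at least 2 it suffices that the cocycle vanishes on the core cells,
   where x and b share neither the first nor the last arrow.  For a cup product
   at a core cell (xx'; bb'), write a, c for the last arrows of x, b and d for the
   first arrow of b'.  If a <> c then ad = 0 by the string condition, and the
   cocycle condition of f at (xd; bd) gives f(x; b) = 0; if a = c, that of g at
   (ax'; ab') gives g(x'; b') = 0. *)
Require Import Defs.
From mathcomp Require Import all_boot all_algebra.
Set Implicit Arguments. Unset Strict Implicit. Unset Printing Implicit Defensive.
Import GRing.Theory.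
Local Open Scope ring_scope.

(** * Bar cochains as functions on sequences *)

Section SeqCochains.
Variables (k : fieldType) (A : lmodType k) (mul : A -> A -> A).
Hypothesis mul_linearl : forall b, linear (mul^~ b).
Hypothesis mul_linearr : forall a, linear (mul a).
Hypothesis mulA : associative mul.

Lemma bmulDr a b c : mul a (b + c) = mul a b + mul a c.
Proof. by have := mul_linearr a 1 b c; rewrite !scale1r. Qed.
Lemma bmul0r a : mul a 0 = 0.
Proof. by have /eqP := bmulDr a 0 0; rewrite addr0 -subr_eq subrr eq_sym => /eqP. Qed.
Lemma bmulZr x a b : mul a (x *: b) = x *: mul a b.
Proof. by have := mul_linearr a x b 0; rewrite !addr0 bmul0r addr0. Qed.
Lemma bmulNr a b : mul a (- b) = - mul a b.
Proof. by rewrite -scaleN1r bmulZr scaleN1r. Qed.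

Lemma bmulDl a b c : mul (b + c) a = mul b a + mul c a.
Proof. by have := mul_linearl a 1 b c; rewrite !scale1r. Qed.
Lemma bmul0l a : mul 0 a = 0.
Proof. by have /eqP := bmulDl a 0 0; rewrite addr0 -subr_eq subrr eq_sym => /eqP. Qed.
Lemma bmulZl x a b : mul (x *: b) a = x *: mul b a.
Proof. by have := mul_linearl a x b 0; rewrite !addr0 bmul0l addr0. Qed.
Lemma bmulNl a b : mul (- b) a = - mul b a.
Proof. by rewrite -scaleN1r bmulZl scaleN1r. Qed.

Implicit Types (f g : seq A -> A) (xs ys zs : seq A).

(* The bar differential without its first term [x_1 f(x_2, ...)]; dropping this
   term makes it recursive in the number of arguments. *)
Fixpoint barR f xs : A :=
  match xs with
  | [::] => 0
  | x :: ys => match ys with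
               | [::] => - mul (f [::]) x
               | y :: zs => - f (mul x y :: zs) - barR (fun us => f (x :: us)) ys
               end
  end.

Definition barD f xs : A := if xs is x :: ys then mul x (f ys) + barR f xs else 0.

Lemma barR_cons f x y zs :
  barR f [:: x, y & zs] = - f (mul x y :: zs) - barR (fun us => f (x :: us)) (y :: zs).
Proof. by []. Qed.

(** On lists of length [n.+1] the operator reads [f] only on lists of length [n], so cochains that
    agree there can be exchanged without functional extensionality. *)
Lemma eq_barR n f g : (forall xs, size xs = n -> f xs = g xs) ->
  forall xs, size xs = n.+1 -> barR f xs = barR g xs.
Proof.
move=> fg xs; elim: xs n f g fg => [|x [|y ys] IH] n f g fg //= [sz].
  by rewrite fg.
case: n sz fg => // n [sz] fg; rewrite fg /= ?sz //.
rewrite -/(barR (fun us => f (x :: us)) (y :: ys)) -/(barR (fun us => g (x :: us)) (y :: ys)).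
by rewrite (IH n _ (fun us => g (x :: us))) //= => [us su|]; [apply: fg; rewrite /= su | rewrite sz].
Qed.

Lemma eq_barD n f g : (forall xs, size xs = n -> f xs = g xs) ->
  forall xs, size xs = n.+1 -> barD f xs = barD g xs.
Proof.
move=> fg [|x xs] // sz; rewrite /barD (eq_barR fg sz) fg //.
by case: sz.
Qed.

Lemma barR_lin c f g xs :
  barR (fun us => c *: f us + g us) xs = c *: barR f xs + barR g xs.
Proof.
elim: xs f g => [|x [|y ys] IH] f g; first by rewrite /= scaler0 addr0.
  by rewrite /= mul_linearl scalerN opprD.
by rewrite !barR_cons IH !opprD scalerDr !scalerN addrACA.
Qed.

Lemma barR0 xs : barR (fun=> 0) xs = 0.
Proof.
elim: xs => [|x [|y ys] IH] //; first by rewrite /= bmul0l oppr0.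
by rewrite barR_cons IH oppr0 addr0.
Qed.

Lemma barRN f xs : barR (fun us => - f us) xs = - barR f xs.
Proof.
have := barR_lin (-1) f (fun=> 0) xs; rewrite barR0 addr0 scaleN1r => <-.
by case: xs => // x xs; apply: (@eq_barR (size xs)) => // us _; rewrite addr0 scaleN1r.
Qed.

Lemma barR_add f g xs : barR (fun us => f us + g us) xs = barR f xs + barR g xs.
Proof.
have := barR_lin 1 f g xs; rewrite scale1r => <-.
by case: xs => // x xs; apply: (@eq_barR (size xs)) => // us _; rewrite scale1r.
Qed.

Lemma barD_add f g xs : barD (fun us => f us + g us) xs = barD f xs + barD g xs.
Proof. by case: xs => [|x xs]; [rewrite /= addr0 | rewrite /barD barR_add bmulDr addrACA]. Qed.

Lemma barD_sub f g xs : barD (fun us => f us - g us) xs = barD f xs - barD g xs.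
Proof.
by case: xs => [|x xs]; [rewrite /= subr0 | rewrite /barD barR_add barRN bmulDr bmulNr opprD addrACA].
Qed.

Lemma barR_mulr a f xs : barR (fun us => mul a (f us)) xs = mul a (barR f xs).
Proof.
elim: xs f => [|x [|y ys] IH] f; first by rewrite /= bmul0r.
  by rewrite /= bmulNr mulA.
by rewrite !barR_cons IH bmulDr !bmulNr.
Qed.

(** [barR] is the bar differential for the bimodule [A] with its left action replaced by zero, so it
    squares to zero: the doubly recursive part vanishes by induction and the remaining products
    cancel by associativity. *)
Lemma barRR n f xs : size xs = n.+2 -> barR (barR f) xs = 0.
Proof.
elim: xs n f => [|x [|y [|z zs]] IH] n f //.
  by rewrite barR_cons /= bmulNl mulA !opprK subrr.
move=> [sz]; rewrite barR_cons.
have -> : barR (fun us => barR f (x :: us)) [:: y, z & zs]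
    = barR (fun us => - (if us is u :: vs then f (mul x u :: vs) else 0) +
              - barR (fun us => f (x :: us)) us) [:: y, z & zs].
  apply: (@eq_barR n); last by rewrite /= sz.
  by case=> [|u vs _]; rewrite ?barR_cons // -sz.
case: n sz => // n [sz].
rewrite barR_add !barRN (IH n) ?[in size _]/= ?sz //.
by rewrite oppr0 addr0 opprK !barR_cons mulA addNr.
Qed.

Lemma barDD n f xs : size xs = n.+2 -> barD (barD f) xs = 0.
Proof.
case: xs => [|x [|y ys]] // [sz]; rewrite /barD -/(barD f).
have -> : barR (barD f) [:: x, y & ys]
    = barR (fun us => (if us is u :: vs then mul u (f vs) else 0) + barR f us) [:: x, y & ys].
  by apply: (@eq_barR n.+1) => [[]|] //=; rewrite ?sz ?addr0.
rewrite barR_add (@barRR n); last by rewrite /= sz.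
by rewrite addr0 barR_cons barR_mulr bmulDr mulA -opprD subrr.
Qed.

Definition scup n f g xs := mul (f (take n xs)) (g (drop n xs)).

(** The last term of [barR f] and the first term of [barD g] give the same product with opposite
    signs; this is why [g] carries the full differential while [f] only carries [barR]. *)
Lemma barR_scup n f g xs : (n < size xs)%N ->
  barR (scup n f g) xs = scup n.+1 (barR f) g xs + (-1) ^+ n *: scup n f (barD g) xs.
Proof.
elim: n f xs => [|n IH] f [|x [|y ys]] // sz.
- by rewrite /scup /= !bmulDr bmulNl bmulNr !mulA scale1r addKr.
- have -> : scup 1 (barR f) g [:: x, y & ys] = - mul (mul (f [::]) x) (g (y :: ys)).
    by rewrite /scup /= bmulNl.
  have -> : scup 0 f (barD g) [:: x, y & ys] =
    mul (f [::]) (mul x (g (y :: ys)) + barR g [:: x, y & ys]) by [].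
  rewrite scale1r bmulDr mulA addKr.
  rewrite -(barR_mulr (f [::]) g [:: x, y & ys]).
  by apply: (@eq_barR (size ys).+1) => //; case.
rewrite barR_cons (IH (fun us => f (x :: us)) (y :: ys)) //.
rewrite {1}/scup /= exprS mulN1r scaleNr opprD addrA; congr (_ + _).
by rewrite /scup /= bmulDl !bmulNl.
Qed.

Lemma barD_scup n f g xs : (n.+1 < size xs)%N ->
  barD (scup n.+1 f g) xs = scup n.+2 (barD f) g xs + (-1) ^+ n.+1 *: scup n.+1 f (barD g) xs.
Proof.
case: xs => // x ys sz; rewrite /barD barR_scup // addrA; congr (_ + _).
by rewrite /scup /= bmulDl mulA.
Qed.
End SeqCochains.

(** * Multilinear cochains on lists *)

Section Multilinear.
Variables (k : fieldType) (A : lmodType k) (mul : A -> A -> A).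
Hypothesis mul_linearl : forall b, linear (mul^~ b).
Hypothesis mul_linearr : forall a, linear (mul a).
Implicit Types (f g : seq A -> A) (xs ys zs : seq A).

(** Only lists of length [n] are constrained; in particular every function satisfies [mlin 0]. *)
Definition mlin n f := forall pre post c a b, (size pre + size post).+1 = n ->
  f (pre ++ (c *: a + b) :: post) = c *: f (pre ++ a :: post) + f (pre ++ b :: post).

Lemma mlin_behead n f x : mlin n.+1 f -> mlin n (fun us => f (x :: us)).
Proof. by move=> fl pre post c a b sz; apply: (fl (x :: pre)); rewrite -sz. Qed.

Lemma mlin_head n f c a b ys : mlin n.+1 f -> size ys = n ->
  f ((c *: a + b) :: ys) = c *: f (a :: ys) + f (b :: ys).
Proof. by move=> fl sz; apply: (fl [::] ys); rewrite -sz. Qed.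

Lemma mlin_cons n f : (forall x, mlin n (fun us => f (x :: us))) ->
  (forall c a b ys, size ys = n ->
     f ((c *: a + b) :: ys) = c *: f (a :: ys) + f (b :: ys)) -> mlin n.+1 f.
Proof.
move=> ft fh [|x pre] post c a b /= [sz]; first exact: fh.
exact: ft.
Qed.

Lemma mlin_add n f g : mlin n f -> mlin n g -> mlin n (fun us => f us + g us).
Proof.
by move=> fl gl pre post c a b sz; rewrite fl // gl // !scalerDr addrACA.
Qed.

Lemma mlin_opp n f : mlin n f -> mlin n (fun us => - f us).
Proof. by move=> fl pre post c a b sz; rewrite fl // opprD scalerN. Qed.

Lemma mlin_sub n f g : mlin n f -> mlin n g -> mlin n (fun us => f us - g us).
Proof. by move=> fl gl; apply: mlin_add => //; apply: mlin_opp. Qed.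

Lemma mlin_barR n f : mlin n f -> mlin n.+1 (barR mul f).
Proof.
elim: n f => [|n IH] f fl.
  apply: mlin_cons => [x [] //|c a b [] //= _].
  by rewrite mul_linearr opprD scalerN.
apply: mlin_cons => [x|c a b [|y ys] // [sz]].
  (* As a function of the tail, [barR f (x :: us)] is a product term plus a recursive one. The
     default 0 on the empty list is never met, since the tails here are nonempty. *)
  have lin_xy : mlin n.+1 (fun us => - (if us is u :: vs then f (mul x u :: vs) else 0)).
    apply/mlin_opp/mlin_cons => [y|c a b ys sz]; first exact: mlin_behead.
    by rewrite mul_linearr (mlin_head _ _ _ fl).
  have /= linR := IH _ (mlin_behead x fl).
  move=> pre post c a b [sz]; have := mlin_sub lin_xy linR c a b (_ : (size pre + size post).+1 = n.+1).
  by rewrite sz => /(_ erefl); case: pre sz => [|y pre] sz.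
rewrite !barR_cons mul_linearl (mlin_head _ _ _ fl); last by rewrite /= sz.
have -> : barR mul (fun us => f (c *: a + b :: us)) (y :: ys) =
    barR mul (fun us => c *: f (a :: us) + f (b :: us)) (y :: ys).
  by apply: (@eq_barR _ _ _ n) => [us su|]; [exact: (mlin_head _ _ _ fl) | rewrite /= sz].
by rewrite barR_lin // !opprD scalerDr !scalerN addrACA.
Qed.

Lemma mlin_barD n f : mlin n f -> mlin n.+1 (barD mul f).
Proof.
move=> fl.
have l1 : mlin n.+1 (fun xs => if xs is x :: ys then mul x (f ys) else 0).
  apply: mlin_cons => [x|c a b ys sz]; last by rewrite mul_linearl.
  by move=> pre post c a b sz; rewrite fl // mul_linearr.
have l2 := mlin_barR fl.
move=> pre post c a b sz; have := mlin_add l1 l2 c a b sz.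
by case: pre sz.
Qed.

Lemma mlin_scup n m f g : mlin n f -> mlin m g -> mlin (n + m) (scup mul n f g).
Proof.
move=> fl gl pre post c a b sz; rewrite /scup !take_cat !drop_cat.
case: ltnP => npre.
  have sg : ((size (drop n pre) + size post).+1 = m).
    by rewrite size_drop; apply/(@addnI n); rewrite -sz addnS addnA subnKC // ltnW.
  by rewrite gl // mul_linearr.
case E : (n - size pre)%N => [|j] /=.
  have {E}sp : size pre = n by apply/eqP; rewrite eqn_leq npre /= -subn_eq0 E.
  have /= -> := gl [::] post c a b; first by rewrite mul_linearr.
  by apply: (@addnI n); rewrite -sz sp addnS.
rewrite fl ?mul_linearl //.
have lt_j : (j <= size post)%N.
  rewrite -(leq_add2l (size pre)) -ltnS -addnS sz -E subnKC // leq_addr //.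
by rewrite size_takel // -addnS -E subnKC.
Qed.

Lemma mlin_has0 n f xs : mlin n f -> size xs = n -> 0 \in xs -> f xs = 0.
Proof.
move=> fl sz /splitPr xs0; case: xs0 sz => pre post sz.
have := fl pre post 1 0 0; rewrite scaler0 addr0 scale1r => /(_ _)/eqP.
rewrite -subr_eq subrr eq_sym => /(_ _)/eqP -> //.
by rewrite -sz size_cat addnS.
Qed.

Lemma mlin_span (I : finType) (e : I -> A) n f :
  (forall a, exists c : I -> k, a = \sum_i c i *: e i) ->
  mlin n f -> (forall is_ : seq I, size is_ = n -> f (map e is_) = 0) ->
  forall xs, size xs = n -> f xs = 0.
Proof.
move=> span; elim: n f => [|n IH] f fl f0 [|x xs] //; first by move=> _; apply: (f0 [::]).
move=> [sz]; have [c ->] := span x.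
elim/big_ind: _ => [|a b fa fb|i _].
- by apply: (mlin_has0 fl); rewrite /= ?sz ?mem_head.
- by rewrite -[a]scale1r (mlin_head _ _ _ fl) // scale1r fa fb addr0.
rewrite -[_ *: _]addr0 (mlin_head _ _ _ fl) // (@mlin_has0 _ _ (0 :: xs) fl) ?mem_head /= ?sz //.
rewrite (IH (fun us => f (e i :: us))) ?scaler0 ?addr0 //; first exact: mlin_behead.
by move=> is_ si; apply: (f0 (i :: is_)); rewrite /= si.
Qed.

(** The two translations are inverse to each other on lists of length [n] only: [seq_cochain] reads
    the first [n] entries and pads a short list with 0. *)
Definition seq_cochain n (f : {ffun 'I_n -> A} -> A) xs := f [ffun i : 'I_n => nth 0 xs i].
Definition ffun_cochain n f (x : {ffun 'I_n -> A}) := f [seq x i | i <- enum 'I_n].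

Lemma multilinear_mlin n (f : {ffun 'I_n -> A} -> A) : multilinear f -> mlin n (seq_cochain f).
Proof.
move=> fl pre post c a b sz.
have lt_pre : (size pre < n)%N by rewrite -sz ltnS leq_addr.
have E d : [ffun i : 'I_n => nth 0 (pre ++ d :: post) i] =
    fupd [ffun i : 'I_n => nth 0 (pre ++ 0 :: post) i] (Ordinal lt_pre) d.
  apply/ffunP => i; rewrite !ffunE !nth_cat -val_eqE /=.
  case: ltngtP => // [lt_i|->]; last by rewrite subnn.
  by rewrite -(subnSK lt_i).
by rewrite /seq_cochain (E (_ + b)) (E a) (E b) fl.
Qed.

Lemma mlin_multilinear n f : mlin n f -> multilinear (@ffun_cochain n f).
Proof.
move=> fl x i c a b; rewrite /ffun_cochain.
have E d : [seq fupd x i d j | j <- enum 'I_n] =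
    take i [seq x j | j <- enum 'I_n] ++ d :: drop i.+1 [seq x j | j <- enum 'I_n].
  apply: (@eq_from_nth _ 0).
    rewrite size_cat [size (d :: _)]/= size_take size_drop !size_map -!enumT size_enum_ord.
    by rewrite ltn_ord subnSK // subnKC // ltnW.
  move=> j; rewrite size_map size_enum_ord => lt_j.
  have nthE (y : {ffun 'I_n -> A}) : [seq y j | j <- enum 'I_n]`_j = y (nth i (enum 'I_n) j).
    by rewrite (nth_map i) // size_enum_ord.
  rewrite nthE ffunE nth_cat size_take size_map size_enum_ord ltn_ord.
  have -> : (nth i (enum 'I_n) j == i) = (j == i :> nat) by rewrite -val_eqE /= nth_enum_ord.
  case: ltngtP => [lt_ji|lt_ij|->]; last by rewrite subnn.
    by rewrite nth_take // nthE.
  by rewrite -(subnSK lt_ij) /= nth_drop subnKC // nthE.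
rewrite !E fl // size_take size_drop size_map size_enum_ord ltn_ord.
by rewrite -addnS subnSK // subnKC // ltnW.
Qed.
End Multilinear.

(** * Comparison with the Hochschild complex of the statement *)

Section Bridge.
Variables (k : fieldType) (A : lmodType k) (mul : A -> A -> A).
Implicit Types (f g : seq A -> A) (xs ys zs : seq A).

Let ffun_seq n (x : {ffun 'I_n -> A}) := [seq x i | i <- enum 'I_n].

Lemma nth_ffun_seq n (x : {ffun 'I_n -> A}) (i : 'I_n) : nth 0 (ffun_seq x) i = x i.
Proof. by rewrite (nth_map i) ?size_enum_ord // nth_ord_enum. Qed.

Lemma size_ffun_seq n (x : {ffun 'I_n -> A}) : size (ffun_seq x) = n.
Proof. by rewrite size_map size_enum_ord. Qed.

Definition merge_at i xs := take i xs ++ mul (nth 0 xs i) (nth 0 xs i.+1) :: drop i.+2 xs.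

Lemma barR_sum n f xs : size xs = n.+1 ->
  barR mul f xs = \sum_(i < n) (-1) ^+ i.+1 *: f (merge_at i xs)
                  + (-1) ^+ n.+1 *: mul (f (take n xs)) (nth 0 xs n).
Proof.
elim: n f xs => [|n IH] f [|x [|y ys]] //; first by rewrite big_ord0 add0r expr1 scaleN1r.
move=> [sz].
rewrite barR_cons (IH (fun us => f (x :: us)) (y :: ys)); last by rewrite /= sz.
rewrite big_ord_recl expr1 scaleN1r opprD addrA; congr (_ + _ + _).
- by rewrite /merge_at /= drop0.
- by rewrite -sumrN; apply: eq_bigr => i _; rewrite -scaleNr [in RHS]exprS mulN1r.
- by rewrite -scaleNr [in RHS]exprS mulN1r.
Qed.

Lemma hoch_dE n (f : {ffun 'I_n -> A} -> A) x :
  hoch_d mul f x = barD mul (seq_cochain f) (ffun_seq x).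
Proof.
have sz := size_ffun_seq x.
have -> : barD mul (seq_cochain f) (ffun_seq x) =
    mul (nth 0 (ffun_seq x) 0) (seq_cochain f (drop 1 (ffun_seq x))) +
    barR mul (seq_cochain f) (ffun_seq x).
  by case: (ffun_seq x) sz => //= a s; rewrite drop0.
rewrite (barR_sum _ sz) addrA /hoch_d; congr (_ + _ + _).
- rewrite (nth_ffun_seq x ord0); congr (mul _ (f _)); apply/ffunP => i.
  by rewrite !ffunE nth_drop -(nth_ffun_seq x (lift ord0 i)).
- apply: eq_bigr => i _; congr (_ *: f _); apply/ffunP => j.
  rewrite !ffunE; change (j == i) with (val j == val i).
  rewrite /merge_at nth_cat size_take sz (ltn_trans (ltn_ord i) (ltnSn n)).
  case: ltngtP => [lt_ji|lt_ij|ji].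
  + by rewrite nth_take // -(nth_ffun_seq x (widen_ord _ j)).
  + by rewrite -(subnSK lt_ij) /= nth_drop addSn subnKC // -(nth_ffun_seq x (lift ord0 j)).
  + rewrite ji subnn /= -(nth_ffun_seq x (lift ord0 j)) -(nth_ffun_seq x (widen_ord _ j)) /=.
    by rewrite /bump /= add1n ji.
- congr (_ *: mul (f _) _); last by rewrite -(nth_ffun_seq x ord_max).
  apply/ffunP => i; rewrite !ffunE nth_take //.
  by rewrite -(nth_ffun_seq x (widen_ord _ i)).
Qed.

Lemma hoch_cupE n m (f : {ffun 'I_n -> A} -> A) (g : {ffun 'I_m -> A} -> A) x :
  hoch_cup mul f g x = scup mul n (seq_cochain f) (seq_cochain g) (ffun_seq x).
Proof.
rewrite /hoch_cup /scup /seq_cochain; congr (mul (f _) (g _)); apply/ffunP => i.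
  by rewrite !ffunE nth_take // -(nth_ffun_seq x (lshift m i)).
by rewrite !ffunE nth_drop -(nth_ffun_seq x (rshift n i)).
Qed.

Lemma ffun_cochainK n f xs : size xs = n -> seq_cochain (@ffun_cochain _ A n f) xs = f xs.
Proof.
move=> sz; rewrite /seq_cochain /ffun_cochain; congr f.
apply: (@eq_from_nth _ 0); rewrite size_map size_enum_ord ?sz // => i lt_i.
rewrite (nth_map (Ordinal lt_i)) ?size_enum_ord // ffunE.
by congr nth; rewrite nth_enum_ord.
Qed.

Lemma hoch_d_ffun n f x :
  hoch_d mul (@ffun_cochain _ A n f) x = barD mul f (ffun_seq x).
Proof.
rewrite hoch_dE; apply: (@eq_barD _ _ _ n); first exact: ffun_cochainK.
by rewrite size_map size_enum_ord.
Qed.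

Lemma seq_cocycle n (f : {ffun 'I_n -> A} -> A) : (forall x, hoch_d mul f x = 0) ->
  forall xs, size xs = n.+1 -> barD mul (seq_cochain f) xs = 0.
Proof.
move=> f0 xs sz; rewrite -(f0 [ffun i : 'I_n.+1 => nth 0 xs i]) hoch_dE; congr barD.
apply: (@eq_from_nth _ 0); first by rewrite size_ffun_seq.
by rewrite sz => i lt_i; rewrite (nth_ffun_seq _ (Ordinal lt_i)) ffunE.
Qed.
End Bridge.

(** * Paths and the path algebra *)

Section Paths.
Variables (V E : finType) (s t : E -> V) (rel : E -> E -> bool).
Hypothesis triang : triangular s t.

Notation P := (V * seq E)%type.
Notation valid := (valid_path s t rel).
Notation tgt := (path_tgt t).
Notation step := (arrow_step s t rel).
Implicit Types (v : V) (a : E) (w : seq E) (x y z b : P).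

(** A repeated vertex would cut out an oriented cycle. Hence a path has fewer arrows than there are
    vertices, which makes the finite list of basis paths complete. *)
Lemma quiver_path_uniq a w : path (fun c d => t c == s d) a w -> uniq (s a :: map t (a :: w)).
Proof.
elim: w a => [|c w IH] a pw.
  by rewrite /= inE eq_sym (triang (w := [::])).
rewrite cons_uniq; apply/andP; split; last first.
  by case/andP: pw => /eqP ac pw; rewrite map_cons ac IH.
apply/mapP => -[d]; rewrite in_cons => /orP[/eqP -> sa_ta|].
  by have := triang (w := [::]) (a := a) isT; rewrite /= -sa_ta eqxx.
move=> dw sa_td; case/path.splitP: dw pw => w1 w2; rewrite cat_path => /andP[pw1 _].
by have := triang pw1; rewrite last_rcons sa_td eqxx.
Qed.

Lemma step_quiver a w : path step a w -> path (fun c d => t c == s d) a w.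
Proof. by apply: sub_path => c d /andP[]. Qed.

Lemma valid_size x : valid x -> (size x.2 < #|V|)%N.
Proof.
case: x => v [|a w] /= pw; first by apply/card_gt0P; exists v.
have /andP[_ /step_quiver/quiver_path_uniq/card_uniqP] := pw.
by move=> /= cV; rewrite /= -(size_map t) -ltnS -cV ltnS max_card.
Qed.

Lemma mem_words n w : (w \in words E n) = (size w <= n)%N.
Proof.
elim: n w => [|n IH] [|a w] //=; rewrite in_cons /=.
rewrite ltnS -IH; apply/allpairsP/idP => [[[a' w'] /= [_ w'_n [_ ->]]] //|w_n].
by exists (a, w); rewrite mem_enum.
Qed.

Lemma mem_paths_list x : (x \in paths_list s t rel) = valid x.
Proof.
rewrite mem_filter; apply: andb_idr => vx; case: x vx => v w vx.
by apply/allpairsP; exists (v, w); rewrite mem_enum mem_words ltnW ?(valid_size vx).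
Qed.

Lemma tgt_cat v w w' : tgt (v, w ++ w') = tgt (tgt (v, w), w').
Proof. by case: w w' => [|a w] // [|c w']; rewrite /path_tgt /= ?cats0 // last_cat. Qed.

Lemma valid_cat v w w' :
  valid (v, w ++ w') = [&& valid (v, w), valid (tgt (v, w), w') &
    if w is a :: u then if w' is c :: _ then ~~ rel (last a u) c else true else true].
Proof.
case: w w' => [|a w] w'; first by rewrite /= andbT.
case: w' => [|c w']; first by rewrite cats0 /= !andbT.
rewrite /valid_path /path_tgt /= cat_path /= /arrow_step (eq_sym (s c)).
by case: (s a == v); case: (path _ a w); case: (t _ == _); case: (path _ c w'); case: rel.
Qed.

Definition pmul x y : option P :=
  if (tgt x == y.1) && valid (x.1, x.2 ++ y.2) then Some (x.1, x.2 ++ y.2) else None.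
(** These quotients invert the partial product [pmul]. The test on vertices matters for a trivial
    path, whose empty word is a prefix and a suffix of every word. *)
Definition ldiv x b : option P :=
  if (b.1 == x.1) && prefix x.2 b.2 then Some (tgt x, drop (size x.2) b.2) else None.
Definition rdiv b x : option P :=
  let b' := (b.1, take (size b.2 - size x.2) b.2) in
  if suffix x.2 b.2 && (tgt b' == x.1) then Some b' else None.

Lemma pmul_ldiv x y b : valid b -> (pmul x y == Some b) = (ldiv x b == Some y).
Proof.
rewrite /pmul /ldiv; case: x y b => [v w] [v' w'] [u c] vb /=; apply/eqP/eqP.
  case: ifP => //= /andP[/eqP <- _] [<- <-].
  by rewrite eqxx prefix_prefix drop_size_cat.
case: ifP => //= /andP[/eqP uv /prefixP[c' cE]] [<- <-].
by rewrite eqxx cE drop_size_cat // -cE -uv vb.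
Qed.

Lemma pmul_rdiv x y b : valid b -> (pmul y x == Some b) = (rdiv b x == Some y).
Proof.
rewrite /pmul /rdiv; case: x y b => [v w] [v' w'] [u c] vb /=; apply/eqP/eqP.
  case: ifP => //= /andP[/eqP <- _] [<- <-].
  by rewrite suffix_suffix size_cat addnK take_size_cat // eqxx.
case: ifP => //= /andP[/suffixP[c' cE] tE] [<- <-]; rewrite tE.
move: tE vb; rewrite cE size_cat addnK take_size_cat // => tE vb.
by rewrite vb.
Qed.

Lemma pmulP x y z : pmul x y = Some z -> [/\ tgt x = y.1, valid z & z = (x.1, x.2 ++ y.2)].
Proof. by rewrite /pmul; case: ifP => // /andP[/eqP -> vz] [<-]. Qed.

Lemma ldiv_valid x b b' : valid b -> ldiv x b = Some b' -> valid b' /\ tgt b' = tgt b.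
Proof.
move=> vb /eqP; rewrite -pmul_ldiv // => /eqP/pmulP[xb' _ bE].
move: vb; rewrite bE valid_cat tgt_cat => /and3P[_ + _].
by rewrite -surjective_pairing xb' -surjective_pairing.
Qed.

Lemma rdiv_valid x b b' : valid b -> rdiv b x = Some b' ->
  [/\ valid b', tgt b' = x.1 & b'.1 = b.1].
Proof.
move=> vb /eqP; rewrite -pmul_rdiv // => /eqP/pmulP[xb' _ bE].
move: vb; rewrite bE valid_cat => /and3P[+ _ _].
by rewrite -surjective_pairing.
Qed.

(** Validity passes to subwords, so an undefined partial product makes the triple product undefined
    in either bracketing. *)
Lemma pmulA x y z : obind (pmul^~ z) (pmul x y) = obind (pmul x) (pmul y z).
Proof.
rewrite /pmul; case: (tgt x =P y.1) => [xy|nxy] /=; last first.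
  by case: ifP => //= _; case: eqP.
case: (boolP (valid (y.1, y.2 ++ z.2))) => vyz; last first.
  rewrite andbF /=; case: ifP => //= vxy.
  rewrite -catA valid_cat -surjective_pairing xy (negPf vyz).
  by rewrite !andbF.
rewrite andbT; case: (tgt y =P z.1) => [yz|nyz] /=.
  rewrite xy eqxx catA /=; case: ifP => //= vxy.
    by rewrite tgt_cat -surjective_pairing xy -surjective_pairing yz eqxx.
  by rewrite valid_cat vxy.
case: ifP => //= vxy; rewrite tgt_cat -surjective_pairing xy -surjective_pairing.
by case: eqP.
Qed.
End Paths.

(** * The path algebra in coordinates *)

Section PathAlgebra.
Variables (V E : finType) (s t : E -> V) (rel : E -> E -> bool) (k : fieldType).
Hypothesis triang : triangular s t.

Notation P := (V * seq E)%type.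
Notation valid := (valid_path s t rel).
Notation tgt := (path_tgt t).
Notation A := (QAlg s t rel k).
Notation B := (QBasis s t rel).
Notation mul := (@qmul V E s t rel k).
Notation vec := (@qvec V E s t rel k).
Notation pmul := (pmul s t rel).
Notation ldiv := (ldiv t).
Notation rdiv := (rdiv t).
Implicit Types (x y z b : P) (a c : A).

Lemma valid_val (i : B) : valid (val i).
Proof. by rewrite -(mem_paths_list _ triang) (valP i). Qed.

Lemma insub_val x (i : B) : (insub x == Some i) = (x == val i).
Proof.
apply/eqP/eqP => [|->]; last exact: valK.
by case: insubP => // j _ <- [->].
Qed.

Lemma bmulE (i j : B) : bmul i j = obind insub (pmul (val i) (val j)).
Proof.
rewrite /bmul /pmul; case: eqP => //= _; case: ifP => //= vij.
by rewrite insubN // (mem_paths_list _ triang) vij.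
Qed.

Lemma bmul_pmul (i j l : B) : (bmul i j == Some l) = (pmul (val i) (val j) == Some (val l)).
Proof.
rewrite bmulE; case: pmul => [z|] //=.
by rewrite insub_val.
Qed.

Lemma qmul_coef a c (l : B) :
  mul a c l = \sum_(i : B) \sum_(j : B) (if bmul i j == Some l then a i * c j else 0).
Proof.
rewrite /qmul sum_ffunE; apply: eq_bigr => i _; rewrite sum_ffunE; apply: eq_bigr => j _.
by rewrite ffunE ffunE; case: ifP; rewrite /GRing.scale /= ?mulr1 ?mulr0.
Qed.

Lemma qmul_linearl c : linear (mul^~ c).
Proof.
move=> x a a'; apply/ffunP => l; rewrite ffunE ffunE !qmul_coef scaler_sumr -big_split.
apply: eq_bigr => i _ /=; rewrite scaler_sumr -big_split; apply: eq_bigr => j _ /=.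
by rewrite !ffunE; case: ifP; rewrite ?scaler0 ?addr0 // mulrDl -scalerAl.
Qed.

Lemma qmul_linearr a : linear (mul a).
Proof.
move=> x c c'; apply/ffunP => l; rewrite ffunE ffunE !qmul_coef scaler_sumr -big_split.
apply: eq_bigr => i _ /=; rewrite scaler_sumr -big_split; apply: eq_bigr => j _ /=.
by rewrite !ffunE; case: ifP; rewrite ?scaler0 ?addr0 // mulrDr -scalerAr.
Qed.

Lemma qvec_span a : a = \sum_(i : B) a i *: vec (Some i).
Proof.
apply/ffunP => l; rewrite sum_ffunE (bigD1 l) //= big1 ?addr0 => [|i il].
  by rewrite !ffunE eqxx /GRing.scale /= mulr1.
rewrite !ffunE (_ : (Some i == Some l) = false) ?scaler0 //.
by apply: negbTE; apply: contraNneq il => -[->].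
Qed.

(** Defined on all words, with value 0 on those that are not valid, so that computations take place
    on words rather than on the subtype of basis elements. *)
Definition qpath x : A := vec (insub x).

Lemma qpath_val (i : B) : qpath (val i) = vec (Some i).
Proof. by rewrite /qpath valK. Qed.

Definition qcoef a b : k := if insub b is Some i then a i else 0.

Lemma qcoef_inj a c : (forall b, valid b -> qcoef a b = qcoef c b) -> a = c.
Proof.
by move=> ac; apply/ffunP => i; have := ac _ (valid_val i); rewrite /qcoef valK.
Qed.

Lemma qcoef_lin (r : k) a c b : qcoef (r *: a + c) b = r * qcoef a b + qcoef c b.
Proof. by rewrite /qcoef; case: insub => [i|]; rewrite ?mulr0 ?addr0 // !ffunE. Qed.
Lemma qcoefD a c b : qcoef (a + c) b = qcoef a b + qcoef c b.
Proof. by rewrite -[a]scale1r qcoef_lin mul1r scale1r. Qed.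
Lemma qcoef0 b : qcoef 0 b = 0.
Proof. by rewrite /qcoef; case: insub => // i; rewrite ffunE. Qed.
Lemma qcoefN a b : qcoef (- a) b = - qcoef a b.
Proof. by rewrite -scaleN1r -[_ *: _]addr0 qcoef_lin qcoef0 addr0 mulN1r. Qed.

(** At most one factorization of [b] begins with [x], so the double sum collapses to one coefficient
    of [c]. *)
Lemma qcoef_qpath_mul x c b : valid x -> valid b ->
  qcoef (mul (qpath x) c) b = oapp (qcoef c) 0 (ldiv x b).
Proof.
rewrite -!(mem_paths_list _ triang) => vx vb.
rewrite -[x](SubK B vx) -[b](SubK B vb); move: (Sub x vx) (Sub b vb) => {vx vb}i l.
rewrite qpath_val /qcoef valK qmul_coef (bigD1 i) //= [X in _ + X]big1 ?addr0; last first.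
  move=> j ji; apply: big1 => j' _; case: ifP => // _; rewrite ffunE.
  rewrite (_ : (Some i == Some j) = false) ?mul0r //.
  by apply: negbTE; apply: contraNneq ji => -[->].
have mulE j : (if bmul i j == Some l then vec (Some i) i * c j else 0) =
    if ldiv (val i) (val l) == Some (val j) then c j else 0.
  by rewrite ffunE eqxx mul1r bmul_pmul pmul_ldiv ?valid_val.
rewrite (eq_bigr _ (fun j _ => mulE j)) {mulE}.
case lE: ldiv => [b'|] /=; last exact: big1.
have [vb' _] := ldiv_valid (valid_val l) lE; move: vb'; rewrite -(mem_paths_list _ triang) => vb'.
rewrite insubT (bigD1 (Sub b' vb')) //= eqxx big1 ?addr0 // => j jb.
by case: eqP => // -[b'E]; case/eqP: jb; apply/val_inj; rewrite /= -b'E.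
Qed.

Lemma qcoef_mul_qpath x c b : valid x -> valid b ->
  qcoef (mul c (qpath x)) b = oapp (qcoef c) 0 (rdiv b x).
Proof.
rewrite -!(mem_paths_list _ triang) => vx vb.
rewrite -[x](SubK B vx) -[b](SubK B vb); move: (Sub x vx) (Sub b vb) => {vx vb}i l.
rewrite qpath_val /qcoef valK qmul_coef exchange_big (bigD1 i) //= [X in _ + X]big1 ?addr0; last first.
  move=> j ji; apply: big1 => j' _; case: ifP => // _; rewrite ffunE.
  rewrite (_ : (Some i == Some j) = false) ?mulr0 //.
  by apply: negbTE; apply: contraNneq ji => -[->].
have mulE j : (if bmul j i == Some l then c j * vec (Some i) i else 0) =
    if rdiv (val l) (val i) == Some (val j) then c j else 0.
  by rewrite ffunE eqxx mulr1 bmul_pmul pmul_rdiv ?valid_val.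
rewrite (eq_bigr _ (fun j _ => mulE j)) {mulE}.
case lE: rdiv => [b'|] /=; last exact: big1.
have [vb' _ _] := rdiv_valid (valid_val l) lE; move: vb'; rewrite -(mem_paths_list _ triang) => vb'.
rewrite insubT (bigD1 (Sub b' vb')) //= eqxx big1 ?addr0 // => j jb.
by case: eqP => // -[b'E]; case/eqP: jb; apply/val_inj; rewrite /= -b'E.
Qed.

Lemma qvec_id (i j : B) : vec (Some i) j = (i == j)%:R.
Proof. by rewrite ffunE (inj_eq (@Some_inj _)); case: eqP. Qed.

Lemma qvec_mul (i j : B) : mul (vec (Some i)) (vec (Some j)) = vec (bmul i j).
Proof.
rewrite /qmul (bigD1 i) //= [X in _ + X]big1 ?addr0 => [|i' i'i]; last first.
  by apply: big1 => j' _; rewrite qvec_id eq_sym (negPf i'i) mul0r scale0r.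
rewrite (bigD1 j) //= [X in _ + X]big1 ?addr0 => [|j' j'j]; last first.
  by rewrite [vec (Some j) _]qvec_id eq_sym (negPf j'j) mulr0 scale0r.
by rewrite !qvec_id !eqxx mulr1 scale1r.
Qed.

Lemma qvec_none : vec None = 0.
Proof. by apply/ffunP => l; rewrite !ffunE. Qed.

Lemma qpath_mul x y : valid x -> valid y -> mul (qpath x) (qpath y) = oapp qpath 0 (pmul x y).
Proof.
rewrite -!(mem_paths_list _ triang) => vx vy.
rewrite -[x](SubK B vx) -[y](SubK B vy) !qpath_val qvec_mul bmulE.
by case: pmul => [z|] //=; rewrite qvec_none.
Qed.

Lemma qpath_ind (p : A -> Prop) : (forall x, valid x -> p (qpath x)) -> p 0 ->
  (forall (r : k) a c, p a -> p c -> p (r *: a + c)) -> forall a, p a.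
Proof.
move=> pq p0 plin a; rewrite (qvec_span a); elim/big_rec: _ => // i c _; apply: plin.
by rewrite -qpath_val; apply/pq/valid_val.
Qed.

(** Trilinearity reduces the claim to paths, where it is [pmulA], an undefined product counting as
    0. *)
Lemma qmulA : associative mul.
Proof.
have linl (r : k) a c c' := qmul_linearl c r a c' : mul (r *: a + c') c = r *: mul a c + mul c' c.
have linr (r : k) a c c' := qmul_linearr a r c c' : mul a (r *: c + c') = r *: mul a c + mul a c'.
have l0 := bmul0l qmul_linearl; have r0 := bmul0r qmul_linearr.
move=> a a' a''; elim/qpath_ind: a => [x vx||c a1 a2 IH1 IH2]; last 2 first.
- by rewrite !l0.
- by rewrite !linl IH1 IH2.
elim/qpath_ind: a' => [y vy||c a1 a2 IH1 IH2]; last 2 first.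
- by rewrite !(l0, r0).
- by rewrite !(linl, linr) IH1 IH2.
elim/qpath_ind: a'' => [z vz||c a1 a2 IH1 IH2]; last 2 first.
- by rewrite !(l0, r0).
- by rewrite !(linl, linr) IH1 IH2.
rewrite !qpath_mul //; have := pmulA s t rel x y z.
case xyE: (pmul x y) => [xy|]; case yzE: (pmul y z) => [yz|] /=; rewrite ?l0 ?r0 // => asso.
- by have [_ vxy _] := pmulP xyE; have [_ vyz _] := pmulP yzE; rewrite !qpath_mul // asso.
- by have [_ vxy _] := pmulP xyE; rewrite qpath_mul // asso.
- by have [_ vyz _] := pmulP yzE; rewrite qpath_mul // -asso.
Qed.

Implicit Types (f g : seq A -> A) (F G : seq P -> P -> k) (xs ys zs : seq P).

(** [rawR] and [rawD] are [barR] and [barD] read on coefficients: multiplying a value by a path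
    becomes dividing [b] by that path. *)
Fixpoint rawR F xs b : k :=
  match xs with
  | [::] => 0
  | x :: ys => match ys with
               | [::] => - oapp (F [::]) 0 (rdiv b x)
               | y :: zs => - oapp (fun z => F (z :: zs) b) 0 (pmul x y)
                            - rawR (fun us => F (x :: us)) ys b
               end
  end.

Definition rawD F xs b : k :=
  if xs is x :: ys then oapp (F ys) 0 (ldiv x b) + rawR F xs b else 0.

Lemma rawR_cons F x y zs b : rawR F [:: x, y & zs] b =
  - oapp (fun z => F (z :: zs) b) 0 (pmul x y) - rawR (fun us => F (x :: us)) (y :: zs) b.
Proof. by []. Qed.

Lemma rawR1 F x b : rawR F [:: x] b = - oapp (F [::]) 0 (rdiv b x).
Proof. by []. Qed.

(* The coefficient of the path b in f(xs), for a tuple of paths xs. *)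
Definition raw f xs b : k := qcoef (f (map qpath xs)) b.

Lemma raw_barR n f xs b : mlin n f -> size xs = n.+1 -> all valid xs -> valid b ->
  raw (barR mul f) xs b = rawR (raw f) xs b.
Proof.
move=> + + + vb; elim: xs n f => [|x [|y ys] IH] n f //.
  by move=> _ _ /andP[vx _]; rewrite /raw /= qcoefN qcoef_mul_qpath.
move=> + [sz]; rewrite -sz => fl /and3P[vx vy vys].
have vyys : all valid (y :: ys) by apply/andP.
have IHx := IH _ _ (mlin_behead (qpath x) fl) erefl vyys.
rewrite rawR_cons -[rawR _ (y :: ys) b]IHx.
rewrite /raw !map_cons barR_cons qcoefD !qcoefN; congr (- _ - _).
rewrite qpath_mul //; case: pmul => //=.
(* When the product of the two paths is zero, [f] has an argument 0 and vanishes by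
   multilinearity. *)
by rewrite (mlin_has0 fl) ?qcoef0 ?mem_head //= size_map.
Qed.

Lemma raw_barD n f xs b : mlin n f -> size xs = n.+1 -> all valid xs -> valid b ->
  raw (barD mul f) xs b = rawD (raw f) xs b.
Proof.
case: xs => // x ys fl sz vxs vb; rewrite /rawD -(raw_barR fl) // -qcoef_qpath_mul ?(andP vxs).1 //.
by rewrite /raw /barD qcoefD.
Qed.

(** The multilinear extension: it turns a homotopy prescribed cell by cell into a cochain. *)
Fixpoint ext F (xs : seq A) : A :=
  if xs is a :: xs' then \sum_(i : B) a i *: ext (fun us => F (val i :: us)) xs'
  else [ffun i => F [::] (val i)].

Lemma ext_mlin n F : mlin n (ext F).
Proof.
elim: n F => [|n IH] F; first by [].
apply: mlin_cons => [a pre post x c c' sz|x a c ys sz] /=.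
  rewrite scaler_sumr -big_split; apply: eq_bigr => i _ /=.
  by rewrite (IH (fun us => F (val i :: us))) // scalerDr !scalerA mulrC.
rewrite scaler_sumr -big_split; apply: eq_bigr => i _ /=.
by rewrite !ffunE scalerDl scalerA.
Qed.

Lemma raw_ext F xs b : all valid xs -> valid b -> raw (ext F) xs b = F xs b.
Proof.
rewrite /raw; elim: xs F => [|x xs IH] F /=.
  rewrite -(mem_paths_list _ triang) => _ vb.
  by rewrite -[b](SubK B vb) /qcoef valK ffunE.
case/andP; rewrite -(mem_paths_list _ triang) => vx vxs vb.
rewrite -[x](SubK B vx); move: (Sub x vx) => j {x vx}.
rewrite qpath_val (bigD1 j) //= big1 ?addr0 => [|i ij].
  by rewrite qvec_id eqxx scale1r IH.
by rewrite qvec_id eq_sym (negPf ij) scale0r.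
Qed.

Lemma eq_rawD n F G xs b : size xs = n.+1 -> all valid xs -> valid b ->
  (forall ys (c : P), size ys = n -> all valid ys -> valid c -> F ys c = G ys c) ->
  rawD F xs b = rawD G xs b.
Proof.
move=> sz vxs vb FG.
have RFG : rawR F xs b = rawR G xs b.
  elim: xs n F G vxs sz FG => [|x [|y ys] IH] n F G // vxs [sz] FG.
    by congr (- _); case rE: rdiv => [c|] //=; apply: FG => //; case: (rdiv_valid vb rE).
  have /and3P[vx vy vys] := vxs; rewrite -sz in FG *.
  rewrite !rawR_cons; congr (- _ - _).
    case zE: pmul => [z|] //=; apply: FG => //; apply/andP; split=> //.
    by case/pmulP: zE.
  apply: (IH (size ys)) => // [|us c su vus vc]; first exact/andP.
  by apply: FG; rewrite /= ?su ?vx.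
case: xs vxs sz RFG => // x ys /andP[vx vys] [sz]; rewrite /rawD => ->; congr (_ + _).
by case lE: ldiv => [c|] //=; apply: FG => //; case: (ldiv_valid vb lE).
Qed.

Lemma raw_eq0 n f : mlin n f ->
  (forall xs b, size xs = n -> all valid xs -> valid b -> raw f xs b = 0) ->
  forall cs : seq A, size cs = n -> f cs = 0.
Proof.
move=> fl f0; apply: (mlin_span (e := fun i : B => vec (Some i)) _ fl) => [a|is_ sz].
  by exists a; exact: qvec_span.
apply: qcoef_inj => b vb; rewrite qcoef0 -(f0 (map val is_) b) ?size_map //.
  by rewrite /raw -map_comp; congr (qcoef (f _) b); apply: eq_map => i; rewrite /= qpath_val.
by rewrite all_map; apply/allP => i _; apply: valid_val.
Qed.

End PathAlgebra.

Arguments rawR : simpl never.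

(** * The matching on cells *)

Section Matching.
Variables (V E : finType) (s t : E -> V) (rel : E -> E -> bool) (k : fieldType).
Hypothesis triang : triangular s t.

Notation P := (V * seq E)%type.
Notation valid := (valid_path s t rel).
Notation tgt := (path_tgt t).
Notation pmul := (pmul s t rel).
Notation ldiv := (ldiv t).
Notation rdiv := (rdiv t).
Notation rawR := (@rawR V E s t rel k).
Notation rawD := (@rawD V E s t rel k).
Implicit Types (v w : V) (o : option E) (b : P) (xs ys zs : seq P) (F G H : seq P -> P -> k).

(* The scan state is the current vertex v and the last arrow read, [None] at the
   start; w is the target of the path b of the cell. *)
Definition zero_after o (a : E) := if o is Some c then rel c a else true.

(* After a run of trivial paths at v, [odd] being the parity of its length so far:
   the cell is in the image of the insertion map when the run is finally odd and
   the next path does not start at v, or finally even and it does. *)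
Fixpoint erun v odd xs w : bool :=
  if xs is x :: ys then
    if x == (v, [::]) then erun v (~~ odd) ys w else odd (+) (x.1 == v)
  else odd (+) (v == w).

(* A nontrivial path having a nonzero product with the arrow before it comes from
   splitting their product. *)
Fixpoint img v o xs w : bool :=
  if xs is x :: ys then
    (x.1 == v) &&
    match x.2 with
    | [::] => erun v true ys w
    | a :: p => if zero_after o a then (p == [::]) && img (t a) (Some a) ys w else true
    end
  else false.

(** The critical cells of the matching, left unpaired: started with [None], these are the Koszul
    cells. *)
Fixpoint crit v o xs w : bool :=
  if xs is x :: ys then
    if x.2 is [:: a] then [&& x.1 == v, zero_after o a & crit (t a) (Some a) ys w] else false
  else v == w.

(** Meaningful on splittable cells, where the arrows passed by the scan form a chain with zero
    products. The first entry breaking this chain is split or preceded by a trivial path; a chain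
    ending at the wrong vertex gets a trivial path at its end. *)
Fixpoint split_cell v o xs : seq P :=
  if xs is x :: ys then
    if x.2 is a :: p then
      if x.1 == v then
        if p is [::] then x :: split_cell (t a) (Some a) ys else [:: (v, [:: a]), (t a, p) & ys]
      else (v, [::]) :: xs
    else (v, [::]) :: xs
  else [:: (v, [::])].

(** The sign with which a cell occurs as a face of its split: each arrow passed contributes -1, and
    so does the product that undoes a splitting. *)
Fixpoint split_sign v o xs : k :=
  if xs is x :: ys then
    if x.2 is a :: p then
      if x.1 == v then
        if p is [::] then - split_sign (t a) (Some a) ys else -1
      else 1
    else 1
  else 1.

Definition splittable v o xs w := ~~ img v o xs w && ~~ crit v o xs w.

Lemma erunN v q xs w : erun v (~~ q) xs w = ~~ erun v q xs w.
Proof.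
elim: xs q => [|x xs IH] q /=; first by rewrite addNb.
by case: ifP => _; [rewrite -IH | rewrite addNb].
Qed.

Lemma split_signK v o xs : split_sign v o xs * split_sign v o xs = 1.
Proof.
elim: xs v o => [|[u [|a [|c p]]] xs IH] v o /=; rewrite ?mulr1 //; case: ifP => _; rewrite ?mulrNN ?mulr1 //.
Qed.

Lemma rdiv_ends x b b' : rdiv b x = Some b' -> b'.1 = b.1 /\ tgt b' = x.1.
Proof. by rewrite /rdiv; case: ifP => // /andP[_ /eqP <-] [<-]. Qed.

Lemma rdiv_trivial v b : rdiv b (v, [::]) = if tgt b == v then Some b else None.
Proof. by rewrite /rdiv suffix0s /= subn0 take_size -surjective_pairing. Qed.

Lemma pmul_trivial v (y : P) : valid y -> pmul (v, [::]) y = if y.1 == v then Some y else None.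
Proof.
case: y => u p vy; rewrite /pmul {1}/path_tgt /= [v == u]eq_sym; case: eqP => //= uv.
by rewrite -uv vy.
Qed.

Lemma rawR_eq0 G xs b : (forall zs b', b'.1 = b.1 -> G zs b' = 0) -> rawR G xs b = 0.
Proof.
elim: xs G => [|x [|y ys] IH] G G0 //.
  by rewrite rawR1; case rE: rdiv => [b'|] /=; rewrite ?oppr0 ?G0 ?oppr0 //; case: (rdiv_ends rE).
rewrite rawR_cons (IH (fun us => G (x :: us))); last by move=> zs b' /G0.
by case: pmul => [z|] /=; rewrite ?G0 ?oppr0 ?addr0.
Qed.

(** Each face in [rawR] keeps [x], extends it on the right or, for a singleton, removes it from the
    end of [b]; the hypotheses on [G] cover all three. *)
Lemma rawR_head0 G x xs b :
  (forall p zs b', b'.1 = b.1 -> G ((x.1, x.2 ++ p) :: zs) b' = 0) ->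
  (forall b', b'.1 = b.1 -> tgt b' = x.1 -> G [::] b' = 0) ->
  rawR G (x :: xs) b = 0.
Proof.
move=> G0 Gnil; case: xs => [|y ys].
  by rewrite rawR1; case rE: rdiv => [b'|] /=; rewrite ?oppr0 //; case: (rdiv_ends rE) => *; rewrite Gnil ?oppr0.
rewrite rawR_cons rawR_eq0 ?subr0; last first.
  by move=> zs b' bb'; have := G0 [::] zs b' bb'; rewrite cats0 -surjective_pairing.
by case pE: pmul => [z|] /=; rewrite ?oppr0 //; case/pmulP: pE => _ _ ->; rewrite G0 ?oppr0.
Qed.

(** The faces deleting one trivial path of the run give the same cell with alternating signs, so
    parity decides whether one survives. Faces beyond the run are killed by the hypothesis on
    [G]. *)
Lemma rawR_erun v q ys G b : all valid ys ->
  (forall zs b', b'.1 = b.1 -> erun v q zs (tgt b') -> G zs b' = 0) ->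
  erun v (~~ q) ys (tgt b) ->
  rawR G ((v, [::]) :: ys) b = if q then - G ys b else 0.
Proof.
elim: ys q G => [|y ys IH] q G vys G0 /=.
  rewrite rawR1 rdiv_trivial eq_sym; case: eqP => _ /=; case: q {G0} => //= _; rewrite oppr0 //.
case/andP: vys => vy vys.
rewrite rawR_cons.
case: (y =P (v, [::])) => [->|ny] runq.
  have pE : pmul (v, [::]) (v, [::]) = Some (v, [::]) by rewrite /pmul /= eqxx.
  rewrite pE (IH (~~ q)) //=; last first.
    by move=> zs b' bb' rz; apply: G0 => //=; rewrite eqxx.
  by case: (q); rewrite /= ?subr0 ?opprK ?addNr.
have qE : q = (y.1 == v) by case: (q) runq; case: eqP.
rewrite rawR_head0 ?subr0; first 1 last.
- move=> p zs b' bb'; apply: G0 => //=; rewrite eqxx /=; case: ifP => [/eqP[yv]|_]; last by [].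
  case y2E : (y.2) => [|//] pE; case: ny.
  by rewrite [y]surjective_pairing yv y2E.
- by move=> b' bb' tb'; apply: G0 => //=; rewrite eqxx /= tb' eq_sym.
rewrite pmul_trivial // -qE.
by case: (q); rewrite //= oppr0.
Qed.

(* [rawD] with its first term kept only when the leading path is trivial: in the
   middle of a scan this accounts for the product with the preceding arrow. *)
Definition barE G xs b : k :=
  (if xs is (_, [::]) :: ys then G ys b else 0) + rawR G xs b.

(** Thus the product of the preceding arrow [c] with the head of the split cell is zero unless that
    head is trivial, the case recorded by the first term of [barE]. *)
Lemma split_head v c xs w : splittable v (Some c) xs w ->
  exists p zs, split_cell v (Some c) xs = (v, p) :: zs /\ if p is a :: _ then rel c a else true.
Proof.
case: xs => [_|[u [|a p]] xs]; rewrite /splittable /=; [by exists [::], [::]|by exists [::]; eexists|].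
case: (u =P v) => [->|_] /=; last by exists [::]; eexists.
case: ifP => //= rca _; case: p => [|a' p]; first by exists [:: a]; eexists.
by exists [:: a]; eexists.
Qed.

Lemma splittable_cons v o a xs w : zero_after o a ->
  splittable v o ((v, [:: a]) :: xs) w = splittable (t a) (Some a) xs w.
Proof. by rewrite /splittable /= eqxx => -> /=. Qed.

(** Induction along the scan. Passing an arrow adds only its product with the next head, which
    [split_head] matches with the first term of [barE]. Where the cell is changed, the face undoing
    the change gives [G xs b]; the other faces are killed by the hypothesis on [G] or cancel inside
    a run of trivial paths. *)
Lemma barE_split xs v o G b : all valid xs ->
  (forall zs b', b'.1 = b.1 -> img v o zs (tgt b') || crit v o zs (tgt b') -> G zs b' = 0) ->
  splittable v o xs (tgt b) ->
  barE G (split_cell v o xs) b = split_sign v o xs * G xs b.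
Proof.
elim: xs v o G => [|[u p] xs IH] v o G vxs G0.
  by rewrite /splittable /barE rawR1 rdiv_trivial eq_sym => /negPf /= ->; rewrite oppr0 addr0 mul1r.
case/andP: vxs => vx vxs.
have bad : u != v -> barE G ((v, [::]) :: (u, p) :: xs) b = 1 * G ((u, p) :: xs) b.
  move=> uv; rewrite /barE rawR_cons mul1r pmul_trivial // (negPf uv) oppr0 add0r.
  rewrite rawR_head0 ?subr0 // => [q zs b' bb'|b' bb' tb'].
    by apply: G0; rewrite //= eqxx xpair_eqE (negPf uv) /=.
  by apply: G0; rewrite //= eqxx tb' (eq_sym v) (negPf uv).
case: p vx bad => [|a p] vx bad; rewrite /splittable /=.
  case: (eqVneq u v) bad => [-> _|uv ->] //; rewrite andbT -erunN => run.
  rewrite /barE rawR_cons pmul_trivial //= eqxx mul1r addrA subrr add0r.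
  rewrite (rawR_erun (q := true)) ?opprK //.
  by move=> zs b' bb' rz; apply: G0; rewrite //= eqxx rz.
case: (eqVneq u v) bad vx => [-> _ vx|uv -> //] /=.
case: (boolP (zero_after o a)) => //= oa; case: p vx => [|c p] vx.
  rewrite eqxx /= => fr.
  have IHx : barE (fun us => G ((v, [:: a]) :: us)) (split_cell (t a) (Some a) xs) b =
      split_sign (t a) (Some a) xs * G ((v, [:: a]) :: xs) b.
    by apply: (IH (t a) (Some a) (fun us => G ((v, [:: a]) :: us))) => // zs b' bb' zz; apply: G0; rewrite //= eqxx oa.
  rewrite mulNr -IHx; have [p [zs [-> ca]]] := split_head fr.
  rewrite /barE rawR_cons add0r -opprD; congr (- (_ + _)).
  case: p ca => [_|d p ad]; rewrite /pmul /path_tgt /= eqxx /=.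
    by rewrite vx.
  by rewrite /valid_path /= /arrow_step ad !andbF.
move=> _; rewrite /barE rawR_cons add0r.
have ac : ~~ rel a c by case/and3P: vx => _ /andP[].
rewrite rawR_head0 ?subr0.
- by rewrite /pmul /path_tgt /= eqxx /= vx mulN1r.
- by move=> q zs b' bb'; apply: G0; rewrite //= eqxx oa /= eqxx (negPf ac).
- by move=> b' bb' tb'; apply: G0; rewrite //= eqxx oa /= tb' eqxx.
Qed.

Lemma valid_cons2 v a c p : valid (v, [:: a, c & p]) =
  [&& valid (v, [:: a]), valid (t a, c :: p) & ~~ rel a c].
Proof. by rewrite (valid_cat _ _ _ _ [:: a] (c :: p)). Qed.

Lemma split_valid v o xs : all valid xs -> all valid (split_cell v o xs).
Proof.
elim: xs v o => [|[u [|a p]] xs IH] v o // /andP[vx vxs].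
rewrite /=.
case: eqP => [uv|_] /=; last by apply/andP.
case: p vx => [|c p] vx; first by apply/andP; split; last exact: IH.
by move: vx; rewrite valid_cons2 uv => /and3P[v1 v2 _]; apply/and3P.
Qed.

Lemma size_split v o xs : size (split_cell v o xs) = (size xs).+1.
Proof.
elim: xs v o => [|[u [|a p]] xs IH] v o //=; case: eqP => //= _.
by case: p => //=; rewrite IH.
Qed.

(** The scan from [None] is needed when the first term of the differential removes the leading
    arrow: the rest is then scanned afresh. *)
Lemma split_img v o xs w : all valid xs -> splittable v o xs w ->
  img v o (split_cell v o xs) w && img v None (split_cell v o xs) w.
Proof.
rewrite /splittable; elim: xs v o => [|[u [|a p]] xs IH] v o vxs /=.
- by rewrite eqxx /= => ->.
- by rewrite !eqxx !andbT /= xpair_eqE eqxx andbT; case: (eqVneq u v) => //= _; rewrite -erunN => ->.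
case: eqP => [uv|uv] /=; last by rewrite !eqxx /= xpair_eqE; case: eqP.
case/andP: vxs => vx vxs; case: (zero_after o a) => //.
case: p vx => [|c p] vx /=.
  by rewrite uv eqxx /= => /(IH _ _ vxs)/andP[-> _]; case: ifP.
move=> _; move: vx; rewrite valid_cons2 => /and3P[_ _ /negPf ac].
by rewrite !eqxx ac; case: ifP.
Qed.

(** In the second alternative the leading path has a nonzero product with the arrow [c] read just
    before it; the cell then comes from splitting this product, one step earlier in the scan. *)
Lemma img_split v o xs w : all valid xs -> img v o xs w ->
  (exists zs, [/\ all valid zs, splittable v o zs w & xs = split_cell v o zs]) \/
  exists c a p ys, [/\ o = Some c, xs = (v, a :: p) :: ys & ~~ rel c a].
Proof.
elim: xs v o => [|[u [|a p]] xs IH] v o // /andP[vx vxs] /= /andP[/eqP uv]; subst u.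
  move=> run; left; exists xs; split=> //.
    case: xs run {IH vxs} => [|[u p] xs] /=; first by rewrite /splittable /= => ->.
    rewrite xpair_eqE; case: eqP => [->|uv] /=.
      case: p => [|a p] /=; last by [].
      by rewrite /splittable /= eqxx andbT -erunN => ->.
    by rewrite /splittable /=; case: p => [|a []] //=; move/eqP/negPf: uv => ->.
  case: xs run {IH vxs} => [|[u [|a p]] xs] //=.
  by rewrite xpair_eqE andbF; case: eqP.
case: ifP => oa; last first.
  by case: o oa => // c /= ca _; right; exists c, a, p, xs; rewrite ca.
case/andP => /eqP pE im; left; subst p.
have [[zs [vzs fzs ->]]|[c [a' [p' [ys [[<-] xsE ca']]]]]] := IH _ _ vxs im.
  exists ((v, [:: a]) :: zs); split; [by apply/andP|by rewrite splittable_cons|by rewrite /= eqxx].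
move: vxs; rewrite xsE => /andP[vy vys].
exists ((v, [:: a, a' & p']) :: ys); split.
- by apply/andP; split=> //; rewrite valid_cons2; apply/and3P.
- by rewrite /splittable /= eqxx oa.
- by rewrite /= eqxx.
Qed.

(* Splitting the leading path a p' off as a, p' leaves the extra boundary term
   a G(p', ...): it is the only one not killed by the vanishing of G. *)
Lemma rawD_split xs G b : all valid xs -> valid b ->
  (forall zs b', img b'.1 None zs (tgt b') || crit b'.1 None zs (tgt b') -> G zs b' = 0) ->
  splittable b.1 None xs (tgt b) ->
  rawD G (split_cell b.1 None xs) b = split_sign b.1 None xs * G xs b +
    if xs is (u, [:: a, c & p]) :: ys then
      oapp (G ((t a, c :: p) :: ys)) 0 (ldiv (u, [:: a]) b)
    else 0.
Proof.
move=> vxs vb G0 fxs; rewrite -(barE_split vxs _ fxs) => [|zs b' <-]; last exact: G0.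
have ldiv_e : ldiv (b.1, [::]) b = Some b.
  by rewrite /ldiv eqxx prefix0s /path_tgt /= drop0 -surjective_pairing.
have DE zs : rawD G ((b.1, [::]) :: zs) b = barE G ((b.1, [::]) :: zs) b.
  by rewrite /rawD ldiv_e.
case: xs vxs fxs => [|[u [|a p]] xs] vxs fxs; rewrite ?DE ?addr0 //.
rewrite [split_cell _ _ _]/=; case: (u =P b.1) fxs vxs => [->|uv] fxs vxs; last first.
  rewrite DE; case: p {fxs vxs} => [|c p]; rewrite ?addr0 //.
  by rewrite /ldiv eq_sym; case: eqP => //=; rewrite addr0.
case: p fxs vxs => [|c p] fxs vxs; last by rewrite /rawD /barE add0r addrC.
rewrite splittable_cons // in fxs; case/andP: vxs => vx vxs.
rewrite /rawD /barE add0r addr0; case lE: ldiv => [b'|] /=; rewrite ?add0r //.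
have b'a : b'.1 = t a by move: lE; rewrite /ldiv; case: ifP => // _ [<-].
have [_ tb'] := ldiv_valid vb lE.
by rewrite G0 ?add0r // b'a tb'; case/andP: (split_img vxs fxs) => _ ->.
Qed.
End Matching.

(** * Reduction to Koszul cells *)

Section Acyclicity.
Variables (V E : finType) (s t : E -> V) (rel : E -> E -> bool) (k : fieldType).
Hypothesis triang : triangular s t.

Notation P := (V * seq E)%type.
Notation valid := (valid_path s t rel).
Notation tgt := (path_tgt t).
Notation A := (QAlg s t rel k).
Notation mul := (@qmul V E s t rel k).
Notation pmul := (pmul s t rel).
Notation ldiv := (ldiv t).
Notation rdiv := (rdiv t).
Notation rawR := (@rawR V E s t rel k).
Notation rawD := (@rawD V E s t rel k).
Notation raw := (@raw V E s t rel k).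
Notation bar := (barD mul).
Implicit Types (v w : V) (o : option E) (b x y : P) (xs ys zs : seq P) (F G H : seq P -> P -> k).
Implicit Types (f h : seq A -> A) (cs : seq A).

Let linl := @qmul_linearl V E s t rel k.
Let linr := @qmul_linearr V E s t rel k.
Let assoc := @qmulA V E s t rel k triang.

Definition cocycle n f := mlin n f /\ forall cs, size cs = n.+1 -> bar f cs = 0.
Definition coboundary n f := exists2 h, mlin n h & forall cs, size cs = n.+1 -> f cs = bar h cs.

Lemma cocycle_sub n f h : cocycle n.+1 f -> mlin n h -> cocycle n.+1 (fun cs => f cs - bar h cs).
Proof.
move=> [fl f0] hl; split=> [|cs sz]; first by apply: mlin_sub => //; apply: mlin_barD.
by rewrite barD_sub // f0 // (barDD linl linr assoc _ sz) subr0.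
Qed.

Lemma coboundary_sub n f h : mlin n h -> coboundary n (fun cs => f cs - bar h cs) -> coboundary n f.
Proof.
move=> hl [h' hl' fE]; exists (fun cs => h cs + h' cs); first exact: mlin_add.
by move=> cs sz; rewrite barD_add // -fE // addrC subrK.
Qed.

(* [raw f] is meaningless on tuples of the wrong length. *)
Definition cut n F xs b : k := if [&& size xs == n, valid b & all valid xs] then F xs b else 0.

Lemma cutE n F xs b : size xs = n -> all valid xs -> valid b -> cut n F xs b = F xs b.
Proof. by move=> sz vxs vb; rewrite /cut sz eqxx vxs vb. Qed.

Lemma raw_cocycle n f xs b : cocycle n f -> size xs = n.+1 -> all valid xs -> valid b ->
  rawD (cut n (raw f)) xs b = 0.
Proof.
move=> [fl f0] sz vxs vb; rewrite (@eq_rawD _ _ _ _ _ _ n _ (raw f)) // => [|ys c]; last first.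
  exact: cutE.
by rewrite -(raw_barD triang fl) // /raw f0 ?size_map // qcoef0.
Qed.

Lemma raw_sub_ext n f H xs b : size xs = n.+1 -> all valid xs -> valid b ->
  raw (fun cs => f cs - bar (ext H) cs) xs b = raw f xs b - rawD H xs b.
Proof.
move=> sz vxs vb; rewrite /raw qcoefD qcoefN; congr (_ - _).
rewrite -[LHS]/(raw (bar (ext H)) xs b) (raw_barD triang (ext_mlin (n := n) H)) //.
by apply: (@eq_rawD _ _ _ _ _ _ n) => // ys c _ vys vc; rewrite raw_ext.
Qed.

Lemma crit_rcons v o ys x w : crit t rel v o (rcons ys x) w -> crit t rel v o ys x.1.
Proof.
elim: ys v o => [|[u [|a [|c p]]] ys IH] v o //=.
  by case: x => u [|a [|c p]] //= /and3P[/eqP ->].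
by case/and3P=> -> -> /IH.
Qed.

Lemma crit_None v o xs w : crit t rel v o xs w -> crit t rel v None xs w.
Proof. by case: xs => [|[u [|a [|c p]]] xs] //= /and3P[-> _ ->]. Qed.

(** Consecutive products in a critical chain vanish, so only the last term survives. *)
Lemma rawR_crit v o ys x w G b : crit t rel v o (rcons ys x) w ->
  rawR G (rcons ys x) b = (-1) ^+ (size ys).+1 * oapp (G ys) 0 (rdiv b x).
Proof.
elim: ys v o G => [|[u [|a [|c p]]] ys IH] v o G //.
  by rewrite rawR1 expr1 mulN1r.
rewrite /= => /and3P[_ _ cr]; have := IH _ _ (fun us => G ((u, [:: a]) :: us)) cr.
case zsE: (rcons ys x) cr => [|y zs]; first by case: (ys) zsE.
case: y zsE => u' [|c [|d p]] //= zsE /and3P[/eqP -> ac _] IHx.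
rewrite rawR_cons IHx [in RHS]exprS mulN1r mulNr /pmul.
by rewrite /valid_path /= /arrow_step ac !andbF /= oppr0 add0r.
Qed.

(** At a Koszul cell the differential only removes the first or the last arrow, and either leaves a
    Koszul cell. So the corrections below do not disturb the vanishing of [f] on Koszul cells. *)
Lemma rawD_crit G xs b : valid b ->
  (forall zs b', crit t rel b'.1 None zs (tgt b') -> G zs b' = 0) ->
  crit t rel b.1 None xs (tgt b) -> rawD G xs b = 0.
Proof.
move=> vb G0; case: xs => // x xs cr; rewrite /rawD.
have -> : oapp (G xs) 0 (ldiv x b) = 0.
  case lE: ldiv => [b'|] //=; rewrite G0 //; have [_ ->] := ldiv_valid vb lE.
  have -> : b'.1 = tgt x by move: lE; rewrite /ldiv; case: ifP => // _ [<-].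
  by case: x cr {lE} => u [|a [|c p]] //= /andP[_ /crit_None].
move: cr; rewrite (lastI x xs) => cr; rewrite (rawR_crit _ _ cr).
case rE: rdiv => [b'|] /=; rewrite ?mulr0 ?addr0 //; have [b1 tb'] := rdiv_ends rE.
by rewrite G0 ?mulr0 ?addr0 // b1 tb'; apply: crit_rcons cr.
Qed.

(** The induction parameter: the extra term of [rawD_split] has a strictly shorter leading path. *)
Definition head_size xs := if xs is x :: _ then size x.2 else 0%N.

Lemma raw0_coboundary n f : mlin n.+1 f ->
  (forall xs b, size xs = n.+1 -> all valid xs -> valid b -> raw f xs b = 0) -> coboundary n f.
Proof.
move=> fl f0; exists (fun=> 0) => [pre post c a a' _|cs sz]; first by rewrite scaler0 addr0.
rewrite (raw_eq0 triang fl f0 sz); case: cs sz => // c cs _.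
by rewrite /barD (bmul0r linr) (barR0 linl) addr0.
Qed.

(** The cocycle equation at the split of a cell expresses the coefficient of that cell through one
    with a shorter leading path, so by induction [f] is zero. *)
Lemma split_vanish_coboundary n f : cocycle n.+1 f ->
  (forall xs b, size xs = n.+1 -> all valid xs -> valid b ->
     crit t rel b.1 None xs (tgt b) -> raw f xs b = 0) ->
  (forall xs b, size xs = n -> all valid xs -> valid b ->
     splittable t rel b.1 None xs (tgt b) -> raw f (split_cell t b.1 None xs) b = 0) ->
  coboundary n f.
Proof.
move=> fc fcrit fsplit; apply: raw0_coboundary fc.1 _.
have fimg zs c : size zs = n.+1 -> all valid zs -> valid c ->
    img t rel c.1 None zs (tgt c) -> raw f zs c = 0.
  move=> sz vzs vc /(img_split vzs)[[ys [vys fys zsE]]|[? [? [? [? []]]]] //].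
  by rewrite zsE fsplit //; move: sz; rewrite zsE size_split => -[].
have cut0 zs c : img t rel c.1 None zs (tgt c) || crit t rel c.1 None zs (tgt c) ->
    cut n.+1 (raw f) zs c = 0.
  move=> zz; rewrite /cut; case: and3P => // -[/eqP sz vc vzs].
  by case/orP: zz => [/fimg|/fcrit] ->.
move=> xs b; have [m] := ubnP (head_size xs); elim: m xs b => // m IH xs b lt_m sz vxs vb.
have [|fr] := boolP (img t rel b.1 None xs (tgt b) || crit t rel b.1 None xs (tgt b)).
  by move/cut0; rewrite cutE.
rewrite negb_or in fr.
have := raw_cocycle fc _ (split_valid b.1 None vxs) vb; rewrite size_split sz => /(_ erefl).
rewrite (rawD_split _ _ cut0 fr) // cutE //.
suff lower : (if xs is (u, [:: a, c & p]) :: ys then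
    oapp (cut n.+1 (raw f) ((t a, c :: p) :: ys)) 0 (ldiv (u, [:: a]) b) else 0) = 0.
  rewrite lower addr0 => /(congr1 ( *%R (split_sign t k b.1 None xs))).
  by rewrite mulrA split_signK mul1r mulr0.
case: xs lt_m sz vxs {fr} => [|[u [|a [|c p]]] xs] lt_m sz vxs //.
case lE: ldiv => [b'|] //=; have [vb' _] := ldiv_valid vb lE.
move: vxs; rewrite /= => /andP[vx vxs]; have := vx; rewrite valid_cons2 => /and3P[_ vy _].
have vyxs : all valid ((t a, c :: p) :: xs) by apply/andP.
by rewrite cutE //; apply: IH.
Qed.

(** Coboundaries are subtracted in stages, by increasing length of the leading path, until [f]
    vanishes on all split cells. A stage preserves the earlier ones because the extra term of
    [rawD_split] only involves shorter leading paths. *)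
Lemma crit_vanish_coboundary n f : cocycle n.+1 f ->
  (forall xs b, size xs = n.+1 -> all valid xs -> valid b ->
     crit t rel b.1 None xs (tgt b) -> raw f xs b = 0) ->
  coboundary n f.
Proof.
(* Leading paths shorter than [l] are already treated; at most [m] stages remain, since valid paths
   have fewer than [#|V|] arrows. *)
suff main m : forall l, (#|V| <= l + m)%N -> forall f, cocycle n.+1 f ->
    (forall xs b, size xs = n.+1 -> all valid xs -> valid b ->
       crit t rel b.1 None xs (tgt b) -> raw f xs b = 0) ->
    (forall xs b, size xs = n -> all valid xs -> valid b -> (head_size xs < l)%N ->
       splittable t rel b.1 None xs (tgt b) -> raw f (split_cell t b.1 None xs) b = 0) ->
    coboundary n f.
  by move=> fc fcrit; apply: (main #|V| 0%N).
elim: m {f} => [|m IH] l lV f fc fcrit fsplit.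
  apply: split_vanish_coboundary => // xs b sz vxs vb; apply: fsplit => //.
  rewrite addn0 in lV; apply: leq_trans lV.
  case: xs vxs {sz} => [_|x xs /andP[vx _]]; last exact: valid_size vx.
  by apply/card_gt0P; exists b.1.
(* This value is forced by [rawD_split]: the differential of [H] must equal [f] on the split of each
   cell treated at this stage. *)
pose H := cut n (fun xs b => if splittable t rel b.1 None xs (tgt b) && (head_size xs == l)
  then split_sign t k b.1 None xs * raw f (split_cell t b.1 None xs) b else 0).
have hl := ext_mlin (s := s) (t := t) (rel := rel) (n := n) H.
have H0 zs c : img t rel c.1 None zs (tgt c) || crit t rel c.1 None zs (tgt c) -> H zs c = 0.
  by rewrite /H /cut /splittable -negb_or => ->; case: ifP.
apply: (coboundary_sub hl); apply: (IH l.+1); rewrite ?addSnnS //.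
- exact: cocycle_sub.
- move=> xs b sz vxs vb cr; rewrite (@raw_sub_ext n) // fcrit // (rawD_crit vb) ?subr0 // => zs c cz.
  by rewrite H0 // cz orbT.
move=> xs b sz vxs vb lt_l fr.
rewrite (@raw_sub_ext n) ?split_valid ?size_split ?sz // (rawD_split _ _ H0 fr) //.
have -> : (if xs is (u, [:: a, c & p]) :: ys then
    oapp (H ((t a, c :: p) :: ys)) 0 (ldiv (u, [:: a]) b) else 0) = 0.
  case: xs lt_l {sz vxs fr} => [|[u [|a [|c p]]] xs] lt_l //.
  case: ldiv => [b'|] //=; rewrite /H /cut; case: ifP => // _.
  by rewrite (ltn_eqF (_ : head_size ((t a, c :: p) :: xs) < l)%N) ?andbF.
rewrite addr0 /H cutE // fr /=; move: lt_l; rewrite ltnS leq_eqVlt => /predU1P[->|lt_l].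
  by rewrite eqxx mulrA split_signK mul1r subrr.
by rewrite fsplit // mulr0 if_same mulr0 subrr.
Qed.
End Acyclicity.

(** * Reduction to core cells *)

Section Koszul.
Variables (V E : finType) (s t : E -> V) (rel : E -> E -> bool) (k : fieldType).
Hypothesis triang : triangular s t.
Hypothesis string : string_cond s t rel.

Notation P := (V * seq E)%type.
Notation valid := (valid_path s t rel).
Notation tgt := (path_tgt t).
Notation A := (QAlg s t rel k).
Notation mul := (@qmul V E s t rel k).
Notation ldiv := (ldiv t).
Notation rdiv := (rdiv t).
Notation rawR := (@rawR V E s t rel k).
Notation rawD := (@rawD V E s t rel k).
Notation raw := (@raw V E s t rel k).
Notation crit := (crit t rel).
Implicit Types (v w : V) (o : option E) (b x y z : P) (xs ys zs : seq P) (F G H : seq P -> P -> k).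
Implicit Types (f h : seq A -> A) (cs : seq A).

Definition arr (a : E) : P := (s a, [:: a]).

Lemma string_left a c d : arrow_step s t rel a d -> arrow_step s t rel c d -> a = c.
Proof.
by move=> ad cd; have [_ /(_ d)[_ /card_le1_eqP]] := string; apply.
Qed.

Lemma string_right a c d : arrow_step s t rel d a -> arrow_step s t rel d c -> a = c.
Proof.
by move=> ad cd; have [_ /(_ d)[/card_le1_eqP + _]] := string; apply.
Qed.

(** A nonempty critical chain is a path of the quiver, so triangularity separates its ends. Any path
    parallel to it is therefore nontrivial. *)
Lemma crit_neq v o x xs w : all valid (x :: xs) -> crit v o (x :: xs) w -> v != w.
Proof.
move=> vxs cr; suff [a [p [qp sa ->]]] : exists a p,
    [/\ path (fun c d => t c == s d) a p, s a = v & w = t (last a p)].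
  by rewrite -sa eq_sym triang.
elim: xs v o x vxs cr => [|y xs IH] v o [u [|a [|c p]]] // /andP[vx vxs] /and3P[/eqP uv _ cr].
all: have sa : s a = v by move: vx => /= /andP[/eqP -> _].
  by exists a, [::]; split=> //; move: cr => /= /eqP.
have [c [p [qp sc ->]]] := IH _ _ _ vxs cr.
by exists a, (c :: p); split=> //=; rewrite sc eqxx.
Qed.

Lemma crit_last v o ys x w : crit v o (rcons ys x) w -> exists2 d, x = (x.1, [:: d]) & t d = w.
Proof.
elim: ys v o => [|[u [|a [|c p]]] ys IH] v o //=; last by move=> /and3P[_ _ /IH].
by case: x => u [|a [|c p]] //= /and3P[_ _ /eqP ta]; exists a.
Qed.

Lemma crit_last2 v o ys y x w : crit v o (rcons (rcons ys y) x) w ->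
  exists c d, [/\ y = (y.1, [:: c]), x = (x.1, [:: d]) & rel c d].
Proof.
elim: ys v o => [|[u [|a [|c p]]] ys IH] v o //=; last by move=> /and3P[_ _ /IH].
case: y => u [|a [|c p]] //= /and3P[_ _]; case: x => u' [|d [|c p]] //= /and3P[_ ad _].
by exists a, d.
Qed.

Lemma crit_head v o x xs w : crit v o (x :: xs) w ->
  exists a, [/\ x = (v, [:: a]), zero_after rel o a & crit (t a) (Some a) xs w].
Proof. by case: x => u [|a [|c p]] //= /and3P[/eqP -> oa cr]; exists a. Qed.

Lemma ldiv_arrow v a c p : ldiv (v, [:: a]) (v, c :: p) = if a == c then Some (t a, p) else None.
Proof. by rewrite /ldiv eqxx /= drop0; case: eqP => //; rewrite prefix0s. Qed.

Lemma rdiv_cat x b b' : rdiv b x = Some b' -> b = (b'.1, b'.2 ++ x.2).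
Proof.
rewrite /rdiv; case: b => v p; case: ifP => // /andP[/suffixP[q /= ->] _] [<-] /=.
by rewrite size_cat addnK take_size_cat.
Qed.

Lemma rdiv_cat_some v p x : tgt (v, p) = x.1 -> rdiv (v, p ++ x.2) x = Some (v, p).
Proof. by move=> px; rewrite /rdiv suffix_suffix size_cat addnK take_size_cat // px eqxx. Qed.

Definition left_ext (c : E) xs b :=
  [&& t c == b.1, valid (s c, c :: b.2) & crit (s c) None (arr c :: xs) (tgt b)].
Definition right_ext (d : E) xs b :=
  valid (b.1, rcons b.2 d) && crit b.1 None (rcons xs (arr d)) (t d).

(** The contracting homotopy of the second pairing. Left extensions take precedence, and the
    divisibility tests discard cells that are not to be extended. The sign undoes the factor
    [(-1) ^+ n.+2] of the last term of the differential. *)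
Definition koszul_homotopy n F xs b : k :=
  if xs is x :: ys then
    if ~~ crit b.1 None xs (tgt b) || (ldiv x b != None) then 0
    else if [pick c | left_ext c xs b] is Some c then F (arr c :: xs) (s c, c :: b.2)
    else if rdiv b (last x ys) != None then 0
    else if [pick d | right_ext d xs b] is Some d then
      (-1) ^+ n * F (rcons xs (arr d)) (b.1, rcons b.2 d)
    else 0
  else 0.

(** By the string condition the first arrow of [b] has at most one predecessor with nonzero product,
    so [pick] has no choice. *)
Lemma left_ext_uniq c d xs b : b.2 != [::] -> left_ext c xs b -> left_ext d xs b -> c = d.
Proof.
case: b => v [|u p] // _ /and3P[_ /andP[_ /andP[cu _]] _] /and3P[_ /andP[_ /andP[du _]] _].
exact: string_left cu du.
Qed.

Lemma right_ext_uniq c d xs b : b.2 != [::] -> right_ext c xs b -> right_ext d xs b -> c = d.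
Proof.
case: b => v [|u p] // _ /andP[+ _] /andP[+ _].
rewrite /valid_path /= !rcons_path => /and3P[_ _ pc] /and3P[_ _ pd].
exact: string_right pc pd.
Qed.

(** Subtracting the differential of the homotopy makes [f] vanish on all Koszul cells. Degree at
    least 2 ensures that removing an arrow leaves a nonempty chain, to which [crit_neq] applies. *)
Lemma core_vanish_coboundary n f : cocycle n.+2 f ->
  (forall x xs b, size (x :: xs) = n.+2 -> all valid (x :: xs) -> valid b ->
     crit b.1 None (x :: xs) (tgt b) ->
     ldiv x b = None -> rdiv b (last x xs) = None -> raw f (x :: xs) b = 0) ->
  coboundary n.+1 f.
Proof.
move=> fc fcore; pose H := cut s t rel n.+1 (koszul_homotopy n (raw f)).
apply: (coboundary_sub (ext_mlin H)); apply: crit_vanish_coboundary => //.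
  by apply: cocycle_sub => //; apply: ext_mlin.
move=> xs b sz vxs vb cr; rewrite (@raw_sub_ext _ _ _ _ _ _ _ n.+1) //.
apply/eqP; rewrite subr_eq0; apply/eqP; symmetry.
case: xs sz vxs cr => [|x ys] // [sz] vxs cr.
have [a [xE _ cra]] := crit_head cr.
have [q bE] : exists uq, b.2 = uq.1 :: uq.2.
  case bE: b.2 => [|u q]; last by exists (u, q).
  by have := crit_neq vxs cr; rewrite /path_tgt bE eqxx.
case: q bE => u q /= bE.
have [vx vys] : valid x /\ all valid ys by apply/andP.
have sa : s a = b.1 by move: vx; rewrite xE /= => /andP[/eqP ->].
case/lastP: ys sz vys vxs cr cra => // zs l; rewrite size_rcons => -[sz] vys vxs cr cra.
have szx : size (x :: zs) = n.+1 by rewrite /= sz.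
have vxzs : all valid (x :: zs).
  by move: vxs; rewrite -rcons_cons all_rcons => /andP[].
have vl : valid l by move: vys; rewrite all_rcons => /andP[].
rewrite -rcons_cons in cr; rewrite /rawD -rcons_cons (rawR_crit _ _ _ cr) szx.
have lE : ldiv x b = if a == u then Some (t a, q) else None.
  by rewrite xE [b in ldiv _ b]surjective_pairing bE ldiv_arrow.
have bvE : b = (s a, u :: q) by rewrite sa -bE -surjective_pairing.
have xarr : x = arr a by rewrite xE /arr sa.
(* With a common first arrow the right term is zero, as the shortened [b] still begins with [a]. The
   left term gives back the cell by left extension with [a]. *)
have [au|au] := eqVneq a u.
  have -> : oapp (H (x :: zs)) 0 (rdiv b l) = 0.
    case rE: rdiv => [b''|] //=; rewrite /H /cut; case: ifP => // _; rewrite /koszul_homotopy.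
    case: ifPn => // ; rewrite negb_or !negbK => /andP[cr'' /eqP].
    have bE' := rdiv_cat rE; have := crit_neq vxzs cr''.
    move: bE; rewrite bE' /path_tgt; case b''E: b''.2 => [|r r'] /=; first by rewrite eqxx.
    by case=> ru _ _; rewrite xE [b'' in ldiv _ b'']surjective_pairing b''E bE' ldiv_arrow au ru eqxx.
  subst u; rewrite eqxx in lE; rewrite mulr0 addr0 lE /=.
  have [vb' tb'] := ldiv_valid vb lE.
  have szl : size (rcons zs l) = n.+1 by rewrite size_rcons sz.
  case ysE: (rcons zs l) vys cra szl => [|y ys] vys cra szl //.
  have [c [yE ac _]] := crit_head cra.
  have cr' : crit (t a) None (y :: ys) (tgt b) := crit_None cra.
  have [r [q' qE]] : exists r q', q = r :: q'.
    case: (q) tb' => [tb'|r q' _]; last by exists r, q'.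
    by have := crit_neq vys cr'; rewrite -tb' eqxx.
  have step_ar : arrow_step s t rel a r by move: vb; rewrite bvE qE => /andP[_ /andP[]].
  have lext : left_ext a (y :: ys) (t a, q).
    rewrite /left_ext eqxx -bvE vb tb' -xarr -ysE -rcons_cons.
    by rewrite sa cr.
  (* The next arrow of the chain has zero product with [a], the next arrow of [b] a nonzero one. *)
  have lE' : ldiv y (t a, q) = None.
    rewrite yE qE ldiv_arrow; case: eqP => // cr_; move: step_ar; rewrite /arrow_step -cr_.
    by rewrite /= in ac; rewrite ac andbF.
  rewrite /H cutE // /koszul_homotopy tb' cr' lE' /=.
  case: pickP => [d dext|/(_ a)]; last by rewrite lext.
  rewrite -(left_ext_uniq _ lext dext) ?qE //.
  by rewrite xarr bvE qE.
rewrite (negPf au) in lE; rewrite lE add0r.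
(* Only the right term is left. If the last arrows also differ, this is a core cell, where both
   sides are zero. *)
case rE: rdiv => [b''|]; last first.
  rewrite mulr0 fcore ?last_rcons //.
  by rewrite -rcons_cons size_rcons szx.
have [vb'' tb'' b''1] := rdiv_valid vb rE; have bcat := rdiv_cat rE.
have cr'' : crit b''.1 None (x :: zs) (tgt b'') by rewrite b''1 tb''; apply: crit_rcons cr.
have [d lE' td] := crit_last cr.
have larr : l = arr d by rewrite lE' /arr; move: vl; rewrite lE' /= => /andP[/eqP ->].
have [q' b''E] : exists q', b'' = (s a, u :: q').
  case b''2: b''.2 => [|r q'].
    by have := crit_neq vxzs cr''; rewrite [tgt b'']/path_tgt b''2 eqxx.
  exists q'; rewrite [LHS]surjective_pairing b''2.
  by move: bcat; rewrite {1}bvE b''2 => -[-> -> _].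
have qE : q = rcons q' d by move: bcat; rewrite {1}bvE b''E lE' -cats1 => -[].
have step_d : arrow_step s t rel (last u q') d.
  by move: vb; rewrite bvE qE /valid_path /= rcons_path => /and3P[].
have lE'' : ldiv x b'' = None.
  by rewrite b''E xE -sa ldiv_arrow (negPf au).
rewrite /= /H cutE // /koszul_homotopy cr'' lE'' /=.
have szxs : size (rcons (x :: zs) l) = n.+2 by rewrite size_rcons szx.
(* Here [H] takes the value of [f] at a left extension by [c]; the cocycle condition of [f] at the
   whole cell extended by [c] turns it into the value wanted. *)
case: pickP => [c cext|nocext].
  have /and3P[/eqP tc vc crc] := cext.
  have cr1 : crit (s c) None (rcons [:: arr c, x & zs] l) (tgt b).
    have [c' [[<-] _ /crit_head[a' [xE' /= ca _]]]] := crit_head crc.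
    move: xE'; rewrite xE => -[_ aa']; rewrite -aa' in ca.
    by rewrite /= !eqxx tc b''1 eqxx ca cra.
  have vcb : valid (s c, c :: b.2).
    move: vc; rewrite b''E bvE qE /valid_path /= eqxx /= rcons_path => /andP[-> ->].
    exact: step_d.
  have vc1 : all valid [:: arr c, x & zs].
    by apply/andP; split=> //; rewrite /valid_path /= eqxx.
  have vcx : all valid (rcons [:: arr c, x & zs] l) by rewrite all_rcons vl vc1.
  have szcx : size [:: arr c, x & zs] = n.+2 by rewrite /= sz.
  have szc : size (rcons [:: arr c, x & zs] l) = n.+3 by rewrite size_rcons szcx.
  have := raw_cocycle triang fc szc vcx vcb.
  rewrite /rawD (rawR_crit _ _ _ cr1) szcx.
  rewrite [rcons [:: arr c, x & zs] l]rcons_cons /= ldiv_arrow eqxx /=.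
  have -> : rdiv (s c, c :: b.2) l = Some (s c, c :: b''.2).
    have -> : c :: b.2 = (c :: b''.2) ++ l.2 by rewrite [in LHS]bcat.
    by apply: rdiv_cat_some; rewrite -tb'' b''E /path_tgt.
  rewrite -/(rcons (x :: zs) l) tc b''1 -surjective_pairing /= !cutE //.
  move/eqP; rewrite addr_eq0 => /eqP ->.
  by rewrite [in RHS]exprS mulN1r mulNr opprK.
(* The arrow before [d] in the chain has zero product with [d], the one before [d] in [b] a nonzero
   one. So [H] falls to the right extension, which must be by [d]. *)
have cr2 : rdiv b'' (last x zs) = None.
  case rE': rdiv => [b3|] //; have b3E := rdiv_cat rE'.
  move: cr; rewrite (lastI x zs) => /crit_last2[e [d' [eE dE ed]]].
  move: dE; rewrite lE' => -[dd']; subst d'.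
  have : last u q' = e.
    move: b3E; rewrite {1}b''E eE => -[_]; case: (b3.2) => [|g p] /= [-> ->] //.
    by rewrite last_cat.
  by move=> lu; move: step_d; rewrite lu /arrow_step ed andbF.
rewrite cr2 /=.
have rext : right_ext d (x :: zs) b''.
  rewrite /right_ext b''E /= -qE -bvE vb sa -larr td; exact: cr.
case: pickP => [d' dext|/(_ d)]; last by rewrite rext.
rewrite -(right_ext_uniq _ rext dext) ?b''E //= -qE -bvE -larr mulrA -exprD.
by rewrite -signr_odd oddD /= negbK addbb mul1r.
Qed.
End Koszul.

(** * The cup product on core cells *)

Section CupProduct.
Variables (V E : finType) (s t : E -> V) (rel : E -> E -> bool) (k : fieldType).
Hypothesis triang : triangular s t.
Hypothesis string : string_cond s t rel.

Notation P := (V * seq E)%type.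
Notation valid := (valid_path s t rel).
Notation tgt := (path_tgt t).
Notation A := (QAlg s t rel k).
Notation mul := (@qmul V E s t rel k).
Notation pmul := (pmul s t rel).
Notation ldiv := (ldiv t).
Notation rdiv := (rdiv t).
Notation rawR := (@rawR V E s t rel k).
Notation rawD := (@rawD V E s t rel k).
Notation raw := (@raw V E s t rel k).
Notation crit := (crit t rel).
Notation arr := (arr s).
Implicit Types (v w : V) (o : option E) (b x y z : P) (xs ys zs : seq P) (F G H : seq P -> P -> k).
Implicit Types (f g h : seq A -> A) (cs : seq A).

Lemma qcoef_mul0 (a c : A) b : valid b ->
  (forall y z, valid y -> valid z -> pmul y z = Some b -> qcoef a y * qcoef c z = 0) ->
  qcoef (mul a c) b = 0.
Proof.
rewrite -{1}(mem_paths_list _ triang) => vb; rewrite -[b](SubK (QBasis s t rel) vb).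
move: (Sub b vb) => l {b vb} ac0; rewrite /qcoef valK qmul_coef.
apply: big1 => i _; apply: big1 => j _; case: ifP => //.
rewrite (bmul_pmul triang) => /eqP ijl.
by have := ac0 _ _ (valid_val triang i) (valid_val triang j) ijl; rewrite /qcoef !valK.
Qed.

Lemma crit_cat v o zs l ys w : crit v o (rcons zs l ++ ys) w ->
  exists a, [/\ l = (l.1, [:: a]), crit v o (rcons zs l) (t a) & crit (t a) (Some a) ys w].
Proof.
elim: zs v o => [|[u [|c [|d p]]] zs IH] v o //=.
  case: l => u [|a [|c p]] //= /and3P[-> oa cr]; exists a; split=> //.
  by rewrite oa eqxx.
by case/and3P=> -> -> /IH[a [lE cr cr']]; exists a.
Qed.

(** Here [z] is any path: below it is a trivial path or an arrow appended to a Koszul chain, and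
    only its product with [l] and its division from [b] survive. *)
Lemma rawR_crit_rcons v o zs l z w G b : crit v o (rcons zs l) w ->
  rawR G (rcons (rcons zs l) z) b = (-1) ^+ (size zs).+1 *
    (oapp (fun u => G (rcons zs u) b) 0 (pmul l z) - oapp (G (rcons zs l)) 0 (rdiv b z)).
Proof.
elim: zs v o G => [|[u [|a [|c p]]] zs IH] v o G //.
  by rewrite rawR_cons rawR1 expr1 mulN1r opprB opprK addrC.
rewrite /= => /and3P[_ _ cr]; have := IH _ _ (fun us => G ((u, [:: a]) :: us)) cr.
case ysE: (rcons zs l) cr => [|y ys]; first by case: (zs) ysE.
case: y ysE => u' [|c [|d p]] //= ysE /and3P[/eqP -> ac _] IHz.
rewrite rawR_cons IHz [in RHS]exprS mulN1r mulNr /pmul.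
by rewrite /valid_path /= /arrow_step ac !andbF /= oppr0 add0r.
Qed.

Lemma ldiv_cat_none x v p q : ldiv x (v, p ++ q) = None -> ldiv x (v, p) = None.
Proof.
rewrite /ldiv /=; case: ifP => // nx _; case: ifP => // /andP[vx /prefixP[p' pE]].
by rewrite vx pE -catA prefix_prefix in nx.
Qed.

Lemma cup_core_eq0 n m f g x xs b : cocycle n.+1 f -> cocycle m.+1 g ->
  size (x :: xs) = (n.+1 + m.+1)%N -> all valid (x :: xs) -> valid b ->
  crit b.1 None (x :: xs) (tgt b) -> ldiv x b = None -> rdiv b (last x xs) = None ->
  raw (scup mul n.+1 f g) (x :: xs) b = 0.
Proof.
move=> fc gc sz vxs vb cr noL noR.
rewrite /raw /scup -map_take -map_drop; apply: qcoef_mul0 => // y z vy vz yzb.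
rewrite -/(raw f _ y) -/(raw g _ z); have [yz _ bE] := pmulP yzb.
set r1 := take _ _; set r2 := drop _ _.
have xsE : x :: xs = r1 ++ r2 by rewrite cat_take_drop.
have sz1 : size r1 = n.+1 by rewrite size_takel // sz leq_addr.
have sz2 : size r2 = m.+1 by rewrite size_drop sz addKn.
have [v1 v2] : all valid r1 /\ all valid r2 by apply/andP; rewrite -all_cat -xsE.
have lastE : last x xs = last x r2.
  have -> : last x xs = last x (x :: xs) by [].
  by rewrite xsE last_cat; case: (r2) sz2.
have [zs' r1E] : exists zs, r1 = x :: zs.
  by case: (r1) sz1 xsE => // c zs _ [-> _]; exists zs.
case/lastP r1r: r1 sz1 => [//|zs l]; rewrite size_rcons => -[szz].
have [a [lE cr1 cr2]] : exists a,
    [/\ l = (l.1, [:: a]), crit b.1 None r1 (t a) & crit (t a) (Some a) r2 (tgt b)].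
  by move: cr; rewrite xsE r1r => /crit_cat.
rewrite -r1r; have sz1 : size r1 = n.+1 by rewrite r1r size_rcons szz.
clearbody r1 r2.
have noLy : ldiv x y = None.
  by rewrite [y]surjective_pairing; apply: (@ldiv_cat_none x y.1 y.2 z.2); rewrite -bE.
have b1 : b.1 = y.1 by rewrite bE.
have vl : valid l by move: v1; rewrite r1r all_rcons => /andP[].
have sa : s a = l.1 by move: vl; rewrite lE /valid_path /= => /andP[/eqP].
have tb : tgt b = tgt z by rewrite bE tgt_cat -surjective_pairing yz -surjective_pairing.
(* The cocycle condition of f at (r1, c), evaluated at a path y' not starting with x. *)
have fcoc c y' : valid c -> valid y' -> ldiv x y' = None ->
    oapp (fun u => cut s t rel n.+1 (raw f) (rcons zs u) y') 0 (pmul l c)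
    = oapp (cut s t rel n.+1 (raw f) r1) 0 (rdiv y' c).
  move=> vc vy' nol.
  have vr : all valid (rcons r1 c) by rewrite all_rcons vc v1.
  have szr : size (rcons r1 c) = n.+2 by rewrite size_rcons sz1.
  have := raw_cocycle triang fc szr vr vy'.
  rewrite {1}r1E rcons_cons /rawD nol add0r -rcons_cons -r1E r1r.
  rewrite r1r in cr1; rewrite (rawR_crit_rcons _ _ _ cr1).
  by move/eqP; rewrite mulf_eq0 signr_eq0 /= subr_eq0 => /eqP ->.
(* If [y] does not end where [r1] does, the cocycle condition of [f] with the trivial path at [t a]
   appended to [r1] makes the coefficient of [f] zero. *)
have [ya|ya] := eqVneq (tgt y) (t a); last first.
  have pE : pmul l (t a, [::]) = Some l.
    by rewrite /pmul /= cats0 -surjective_pairing vl andbT lE /path_tgt /= eqxx.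
  have := fcoc (t a, [::]) y isT vy noLy.
  rewrite pE rdiv_trivial (negPf ya) /= -r1r cutE // => ->.
  by rewrite mul0r.
have y2 : y.2 != [::].
  apply/negP => /eqP y2; have := cr1; rewrite r1E => cr1'.
  have := v1; rewrite r1E => v1'; have := crit_neq triang v1' cr1'.
  by rewrite -ya b1 /path_tgt y2 eqxx.
have z2 : z.2 != [::].
  apply/negP => /eqP z2; move: cr2 v2 sz2; case: (r2) => // c r2' cr2' v2' _.
  by have := crit_neq triang v2' cr2'; rewrite tb -ya yz /path_tgt z2 eqxx.
case/lastP y2E: y.2 y2 => [//|p c] _; case z2E: z.2 z2 => [//|d q] _.
have cd : arrow_step s t rel c d.
  by move: vb; rewrite bE y2E z2E cat_rcons valid_cat => /and3P[_ /andP[_ /andP[]]].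
have sd : s d = tgt y by move: vz; rewrite /valid_path z2E -yz => /andP[/eqP].
have [ac|ac] := eqVneq a c.
  subst c.
  have vaz : valid (l.1, a :: z.2).
    by move: vz; rewrite /valid_path z2E /= cd sa eqxx => /andP[_ ->].
  have szr : size (l :: r2) = m.+2 by rewrite /= sz2.
  have vr : all valid (l :: r2) by apply/andP.
  have crl : crit l.1 None (l :: r2) (tgt (l.1, a :: z.2)).
    have -> : tgt (l.1, a :: z.2) = tgt b by rewrite tb /path_tgt z2E.
    by rewrite {2}lE /= eqxx cr2.
  have := raw_cocycle triang gc szr vr vaz.
  rewrite /rawD {1}lE ldiv_arrow eqxx /= -{1}ya yz -surjective_pairing cutE //.
  move: crl; rewrite (lastI l r2) => crl; rewrite (rawR_crit _ _ _ crl).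
  (* As [z] is nontrivial, a last arrow shared here would also be shared by [x :: xs] and [b], which
     [noR] excludes. *)
  have -> : rdiv (l.1, a :: z.2) (last l r2) = None.
    case rE: rdiv => [u|] //; have [_ tu] := rdiv_ends rE; have uE := rdiv_cat rE.
    have [e leE _] := crit_last crl.
    move: noR; rewrite lastE (_ : last x r2 = last l r2); last by case: (r2) sz2.
    rewrite bE y2E cat_rcons; case: (uE) => _ ->; rewrite catA.
    rewrite rdiv_cat_some // tgt_cat.
    move: tu; rewrite [u]surjective_pairing; case: (u.2) uE => //.
    by rewrite leE z2E => -[_ ] [].
  by rewrite mulr0 addr0 => ->; rewrite mulr0.
have rad : rel a d.
  apply: contraNT ac => rad; apply/eqP/(string_left string _ cd).
  by rewrite /arrow_step rad sd ya eqxx.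
have y'E : rcons y.2 d ++ q = y.2 ++ z.2 by rewrite z2E cat_rcons.
have vy' : valid (y.1, rcons y.2 d).
  by move: vb; rewrite bE -y'E valid_cat => /and3P[].
have := fcoc (arr d) (y.1, rcons y.2 d) _ vy' _.
have -> : pmul l (arr d) = None.
  by rewrite /pmul lE /valid_path /= /arrow_step rad !andbF.
have -> : rdiv (y.1, rcons y.2 d) (arr d) = Some y.
  by rewrite -cats1 (@rdiv_cat_some _ _ t y.1 y.2 (arr d)) -?surjective_pairing.
rewrite /= cutE // => <- //; first by rewrite mul0r.
- by rewrite /valid_path /= eqxx.
- by apply: (@ldiv_cat_none x _ _ q); rewrite y'E -bE.
Qed.
End CupProduct.

(** * Conclusion for Hochschild classes *)

Lemma cocycle_scup (k : fieldType) (V E : finType) (s t : E -> V) (rel : E -> E -> bool) n m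
    (f g : seq (QAlg s t rel k) -> QAlg s t rel k) : triangular s t ->
  cocycle n.+1 f -> cocycle m g -> cocycle (n.+1 + m) (scup (@qmul V E s t rel k) n.+1 f g).
Proof.
move=> triang [fl f0] [gl g0].
have linl := @qmul_linearl V E s t rel k; have linr := @qmul_linearr V E s t rel k.
split=> [|cs sz]; first exact: mlin_scup.
rewrite (barD_scup linl linr (qmulA triang)) ?sz ?ltnS ?leq_addr //.
rewrite /scup f0 ?size_takel ?sz ?ltnS ?leq_addr // g0 ?size_drop ?sz; last first.
  by rewrite -addnS addKn.
by rewrite (bmul0l linl) (bmul0r linr) scaler0 addr0.
Qed.

Theorem theorem3p1 (k : fieldType) (V E : finType) (s t : E -> V)
    (rel : E -> E -> bool) :
  triangular s t -> string_cond s t rel ->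
  forall (n m : nat)
    (f : {ffun 'I_n.+1 -> QAlg s t rel k} -> QAlg s t rel k)
    (g : {ffun 'I_m.+1 -> QAlg s t rel k} -> QAlg s t rel k),
    hoch_cocycle (@qmul V E s t rel k) f ->
    hoch_cocycle (@qmul V E s t rel k) g ->
    exists h : {ffun 'I_(n + m.+1) -> QAlg s t rel k} -> QAlg s t rel k,
      multilinear h /\
      forall x : {ffun 'I_(n.+1 + m.+1) -> QAlg s t rel k},
        hoch_d (@qmul V E s t rel k) h x = hoch_cup (@qmul V E s t rel k) f g x.
Proof.
move=> triang string n m f g [fl f0] [gl g0].
have fc : cocycle n.+1 (seq_cochain f).
  by split; [exact: multilinear_mlin | exact: seq_cocycle].
have gc : cocycle m.+1 (seq_cochain g).
  by split; [exact: multilinear_mlin | exact: seq_cocycle].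
have [h hl hE] : coboundary (n + m.+1) (scup (@qmul V E s t rel k) n.+1 (seq_cochain f) (seq_cochain g)).
  (* Both degrees being positive, the total degree is [(n + m).+2], as [core_vanish_coboundary]
     requires. *)
  have cupc := cocycle_scup triang fc gc; rewrite addnS.
  apply: (core_vanish_coboundary triang string); first by rewrite -addnS.
  move=> x xs b sz vxs vb cr noL noR.
  by apply: (cup_core_eq0 triang string fc gc) => //; rewrite sz addSn addnS.
exists (@ffun_cochain _ _ _ h); split; first exact: mlin_multilinear.
by move=> x; rewrite hoch_d_ffun hoch_cupE hE // size_map size_enum_ord.
Qed.
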